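(* Let $\varphi\in\Bbbk(x,y)\setminus\Bbbk$ be a rational function that does not possess a polynomial generative function. Let $p,q\in\Bbbk[x,y]$ be algebraically independent and irreducible polynomials such that $p/q$ is a generative rational function for $\varphi$. Then: (1) for every nonzero element $f\delta_{p,q}\in\mathcal{A}_{W_2}(\varphi)$ (with $f\in\Bbbk[x,y]$, $f\ne 0$), its centralizer in $\mathcal{A}_{W_2}(\varphi)$ coincides with $\Bbbk[p,q]_m\cdot\bar f\,\delta_{p,q}$, where $\bar f$ is a $p$-$q$-free polynomial such that $f=\bar f\cdot h$ for some polynomial $h$ homogeneous of degree $m$ in $p$ and $q$; (2) every maximal abelian subalgebra of $\mathcal{A}_{W_2}(\varphi)$ is of the form $\Bbbk[p,q]_m\,\bar f\,\delta_{p,q}$ for some integer $m\ge 0$ and some $p$-$q$-free polynomial $\bar f$. Conversely, every subspace of the form $\Bbbk[p,q]_m\,\bar f\,\delta_{p,q}$, with $m\ge 0$ an integer and $\bar f$ a $p$-$q$-free polynomial, is a maximal abelian subalgebra of $\mathcal{A}_{W_2}(\varphi)$. In particular, all maximal abelian subalgebras of $\mathcal{A}_{W_2}(\varphi)$ are finite dimensional over $\Bbbk$.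
   Context: $\Bbbk$ is an algebraically closed field of characteristic zero. $W_2=W_2(\Bbbk)$ is the Lie algebra of all $\Bbbk$-derivations of $\Bbbk[x,y]$ with bracket $[D_1,D_2]=D_1D_2-D_2D_1$; each $D\in W_2$ extends uniquely to a derivation of $\Bbbk(x,y)$. For $\varphi\in\Bbbk(x,y)\setminus\Bbbk$, the annihilator of $\varphi$ is the Lie subalgebra $\mathcal{A}_{W_2}(\varphi)=\{D\in W_2 : D(\varphi)=0\}$ of $W_2$. A generative rational function of $\varphi\in\Bbbk(x,y)\setminus\Bbbk$ is a generator (over $\Bbbk$) of the maximal subfield of $\Bbbk(x,y)$ of transcendence degree $1$ over $\Bbbk$ that contains $\varphi$. If $\varphi$ has no polynomial generative function, it has a generative function $p/q$ with $p,q\in\Bbbk[x,y]$ irreducible and algebraically independent over $\Bbbk$. For irreducible algebraically independent $p,q\in\Bbbk[x,y]$ let $P_0=p\frac{\partial q}{\partial y}-q\frac{\partial p}{\partial y}$, $Q_0=q\frac{\partial p}{\partial x}-p\frac{\partial q}{\partial x}$, $d=\gcd(P_0,Q_0)$, and $$\delta_{p,q}=\frac1d\left(P_0\frac{\partial}{\partial x}+Q_0\frac{\partial}{\partial y}\right)\in W_2,$$ which is defined up to a nonzero constant factor. When $\varphi$ has no polynomial generative function and $p/q$ is a generative function of $\varphi$ with $p,q\in\Bbbk[x,y]$ irreducible and algebraically independent over $\Bbbk$, the $\Bbbk[x,y]$-module $\mathcal{A}_{W_2}(\varphi)$ is free of rank $1$ with generator $\delta_{p,q}$, so every element of it has the form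 $f\delta_{p,q}$ with $f\in\Bbbk[x,y]$. For an integer $m\ge0$, $\Bbbk[p,q]_m$ denotes the vector space of all polynomials $F(p,q)$ where $F\in\Bbbk[s,t]$ is a homogeneous polynomial of degree $m$ (including $F=0$). A polynomial ''homogeneous of degree $m$ in $p$ and $q$'' is an element $F(p,q)$ with $F$ homogeneous of degree $m$. A polynomial $f\in\Bbbk[x,y]$ is called $p$-$q$-free if $f$ is not divisible (in $\Bbbk[x,y]$) by any polynomial $F(p,q)$ with $F$ homogeneous of positive degree (in particular $f\neq0$). For every nonzero $f\in\Bbbk[x,y]$ there is a $p$-$q$-free $\bar f$ with $f=\bar f h$ for some $h$ homogeneous in $p$ and $q$. $\Bbbk[p,q]_m\,\bar f\,\delta_{p,q}=\{g\bar f\delta_{p,q}: g\in\Bbbk[p,q]_m\}$. *)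

(* Defs.v *)
From HB Require Import structures.
From mathcomp Require Import all_boot all_order all_algebra.
From mathcomp.multinomials Require Export mpoly.

Set Implicit Arguments.
Unset Strict Implicit.
Unset Printing Implicit Defensive.

Import GRing.Theory.
Local Open Scope ring_scope.

Notation "x %:F" := (tofrac x) : ring_scope.

(* Subsets of k[x,y], of k(x,y) and of W_2(k) are Prop-valued
   predicates, so that maximality ranges over arbitrary subsets. *)

Section Generic.
Variables (k : fieldType) (A : comNzRingType) (iota : k -> A).

(* k-derivations of A, where the k-algebra structure is given by iota *)
Definition is_derivation (D : A -> A) : Prop :=
  [/\ forall u v, D (u + v) = D u + D v,
      forall c u, D (iota c * u) = iota c * D u &
      forall u v, D (u * v) = D u * v + u * D v].

Definition alg_independent (n : nat) (u : 'I_n -> A) : Prop :=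
  forall F : {mpoly k[n]}, mmap iota u F = 0 -> F = 0.

End Generic.

Section Divisibility.
Variable R : comUnitRingType.
Implicit Types a b d : R.

Definition divides d a : Prop := exists c, a = d * c.

Definition is_gcd d a b : Prop :=
  [/\ divides d a, divides d b &
      forall e, divides e a -> divides e b -> divides e d].

Definition irreducible a : Prop :=
  [/\ a != 0, a \isn't a GRing.unit &
      forall b c, a = b * c -> b \is a GRing.unit \/ c \is a GRing.unit].

End Divisibility.

Section RationalFunctions.
Variable k : fieldType.

Definition ratfun2 := {fraction {mpoly k[2]}}.

Definition polyconst (c : k) : {mpoly k[2]} := c%:MP.
Definition ratconst (c : k) : ratfun2 := (c%:MP : {mpoly k[2]})%:F.

(* intermediate fields of k(x,y) / k *)
Definition is_subfield (K : ratfun2 -> Prop) : Prop :=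
  [/\ forall c, K (ratconst c),
      forall u v, K u -> K v -> K (u - v),
      forall u v, K u -> K v -> K (u * v) &
      forall u, K u -> K u^-1].

Definition has_trdeg (K : ratfun2 -> Prop) (n : nat) : Prop :=
  (exists u : 'I_n -> ratfun2,
     (forall i, K (u i)) /\ alg_independent ratconst u) /\
  (forall m (u : 'I_m -> ratfun2),
     (forall i, K (u i)) -> alg_independent ratconst u -> (m <= n)%N).

Definition trdeg1_subfield_with (phi : ratfun2) (K : ratfun2 -> Prop) : Prop :=
  [/\ is_subfield K, has_trdeg K 1 & K phi].

Definition maximal_trdeg1_subfield_with
    (phi : ratfun2) (K : ratfun2 -> Prop) : Prop :=
  trdeg1_subfield_with phi K /\
  forall K', trdeg1_subfield_with phi K' ->
    (forall u, K u -> K' u) -> forall u, K' u -> K u.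

Definition adjoin (g : ratfun2) : ratfun2 -> Prop :=
  fun u => forall K, is_subfield K -> K g -> K u.

Definition generative (phi g : ratfun2) : Prop :=
  maximal_trdeg1_subfield_with phi (adjoin g).

End RationalFunctions.

Section LieAlgebra.
Variable k : fieldType.
Local Notation kxy := {mpoly k[2]}.
Implicit Types (D E : kxy -> kxy) (S T B : (kxy -> kxy) -> Prop).

Definition W2 D : Prop := is_derivation (@polyconst k) D.

Definition bracket D E : kxy -> kxy := fun u => D (E u) - E (D u).

(* D(phi) = 0 for the (unique) derivation of k(x,y) extending D *)
Definition annihilator (phi : ratfun2 k) D : Prop :=
  W2 D /\
  exists D' : ratfun2 k -> ratfun2 k,
    [/\ is_derivation (@ratconst k) D',
        forall u : kxy, D' u%:F = (D u)%:F &
        D' phi = 0].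

Definition is_subspace S : Prop :=
  S (fun _ => 0) /\
  forall (a : k) D E, S D -> S E -> S (fun u => a *: D u + E u).

Definition is_lie_subalgebra B S : Prop :=
  [/\ forall D, S D -> B D, is_subspace S &
      forall D E, S D -> S E -> S (bracket D E)].

Definition is_abelian_subalgebra B S : Prop :=
  is_lie_subalgebra B S /\
  forall D E, S D -> S E -> bracket D E = (fun _ => 0).

Definition is_maximal_abelian_subalgebra B S : Prop :=
  is_abelian_subalgebra B S /\
  forall T, is_abelian_subalgebra B T ->
    (forall D, S D -> T D) -> forall D, T D -> S D.

Definition centralizer B D : (kxy -> kxy) -> Prop :=
  fun E => B E /\ bracket D E = (fun _ => 0).

Definition finite_dimensional S : Prop :=
  exists (n : nat) (b : 'I_n -> kxy -> kxy),
    (forall i, S (b i)) /\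
    forall D, S D ->
      exists c : 'I_n -> k, D = (fun u => \sum_(i < n) c i *: b i u).

(* f D, for the k[x,y]-module structure of W_2 *)
Definition scale_der (f : kxy) D : kxy -> kxy := fun u => f * D u.

End LieAlgebra.

Section PQ.
Variable k : fieldType.
Local Notation kxy := {mpoly k[2]}.
Variables p q : kxy.

Definition xvar : 'I_2 := ord0.
Definition yvar : 'I_2 := ord_max.

(* delta is one of the scalar multiples of delta_{p,q}, one for each choice
   of the gcd d *)
Definition is_delta (delta : kxy -> kxy) : Prop :=
  let P0 := p * q^`M(yvar) - q * p^`M(yvar) in
  let Q0 := q * p^`M(xvar) - p * q^`M(xvar) in
  exists d P Q : kxy,
    [/\ is_gcd d P0 Q0, P0 = d * P, Q0 = d * Q &
        delta = (fun u => P * u^`M(xvar) + Q * u^`M(yvar))].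

(* the elements of k[p,q]_m; 0 is m.-homog for every m *)
Definition pq_homog (m : nat) (g : kxy) : Prop :=
  exists2 F : {mpoly k[2]}, F \is m.-homog & g = F \mPo [tuple p; q].

Definition pq_free (f : kxy) : Prop :=
  forall (m : nat) (g : kxy), (0 < m)%N -> pq_homog m g -> ~ divides g f.

(* the subspace k[p,q]_m fbar delta of W_2 *)
Definition pq_space (m : nat) (fbar : kxy) (delta : kxy -> kxy)
    : (kxy -> kxy) -> Prop :=
  fun D => exists2 g, pq_homog m g & D = scale_der (g * fbar) delta.

End PQ.

(* Main.v *)
Require Import Defs.
From HB Require Import structures.
From mathcomp Require Import all_boot all_order all_algebra.
From mathcomp.multinomials Require Import mpoly.
From mathcomp Require Import ring.
From Stdlib Require Import Classical FunctionalExtensionality.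

(** The derivation delta multiplies p and q by the same rational function, so
  it multiplies every form of degree m in p and q by m times that function and
  kills the quotients of two forms of equal degree.  Since
  [f delta, g delta] = (f delta(g) - g delta(f)) delta, the elements f delta and
  g delta commute exactly when delta kills g / f.

  The kernel of delta in k(x,y) is a field containing p/q, and it has
  transcendence degree 1: were u, v algebraically independent and killed by a
  derivation, then x and y would be algebraic over k(u,v) and hence killed too
  ([der_indep_eq0]; the algebraic dependence comes from counting the monomials
  of bounded degree in three polynomials, [trivariate_dependence]).  As p/q is
  generative, the kernel is therefore k(p/q) ([der_kernel_generative]), whose
  elements are the quotients A / B of forms of equal degree in p and q
  ([adjoin_homog]).

  If f = fbar h with fbar p-q-free and h a form of degree m, then g / f = A / B
  reads g B = fbar h A.  Over an algebraically closed field B is a product of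
  linear forms in p and q.  Such a linear form l divides fbar (h A), and it is
  coprime to one of p and q, say b.  Division of the form h A by l leaves a
  remainder c b ^ j with c constant; if c were nonzero, then l would divide
  fbar b ^ j and hence fbar, against p-q-freeness.  So l divides h A, with a
  form as cofactor.  Cancelling the factors of B one after the other gives
  g = fbar h' with h' a form of degree m ([pq_free_quotient]).  This is the
  description of centralizers ([centralizerP]), and maximal abelian subalgebras
  follow formally: one of them is contained in the centralizer of any of its
  nonzero elements, and each such centralizer is abelian.

  A derivation which kills phi also kills p/q, which is algebraic over k(phi)
  ([der_generative]); as the two coefficients of delta are coprime, it is then a
  polynomial multiple of delta ([annihilatorP]).  The cancellations use that a
  divisor of a Q coprime to Q divides a; it is proved in k[x][y]
  ([bivariate_euclid]), where the irreducible constants are the x - r. *)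

Import GRing.Theory.
Local Open Scope ring_scope.

Set Implicit Arguments.
Unset Strict Implicit.
Unset Printing Implicit Defensive.

(** * Euclid's lemma in k[x][y] *)

Definition coprime_elts (R : comUnitRingType) (a b : R) : Prop :=
  forall e, divides e a -> divides e b -> e \is a GRing.unit.

Lemma coprime_elts_sym (R : comUnitRingType) (a b : R) :
  coprime_elts a b -> coprime_elts b a.
Proof. by move=> cab e eb ea; apply: cab. Qed.

Lemma divides_mulr (R : comUnitRingType) (d a b : R) :
  divides d a -> divides d (a * b).
Proof. by case=> c ->; exists (c * b); rewrite mulrA. Qed.

Lemma divides_trans (R : comUnitRingType) (b a c : R) :
  divides a b -> divides b c -> divides a c.
Proof. by case=> x -> [y ->]; exists (x * y); rewrite mulrA. Qed.

Section Bivariate.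
Variable k : closedFieldType.
Local Notation kx := {poly k}.
Local Notation kxy := {poly {poly k}}.

(** The irreducible elements of k[x], up to units, seen as constants of
  k[x][y]. *)
Definition vertical_line (r : k) : kxy := ('X - r%:P)%:P.

Lemma vertical_line_neq0 r : vertical_line r != 0.
Proof. by rewrite polyC_eq0 polyXsubC_eq0. Qed.

Lemma divides_vertical_lineP r (F : kxy) :
  divides (vertical_line r) F <-> map_poly (horner_eval r) F = 0.
Proof.
split.
  move=> [G ->]; rewrite rmorphM /= map_polyC /= /horner_eval hornerXsubC subrr.
  by rewrite mul0r.
move=> F0; exists (map_poly (fun c => c %/ ('X - r%:P)) F).
apply/polyP=> i; rewrite coefCM coef_map_id0 ?div0p // mulrC divpK //.
rewrite dvdp_XsubCl /root -[_.[r]]/(horner_eval r _) -coef_map.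
by rewrite F0 coef0.
Qed.

(** Reduction modulo x - r maps onto k[y], an integral domain. *)
Lemma vertical_line_prime r (F G : kxy) :
  divides (vertical_line r) (F * G) ->
  divides (vertical_line r) F \/ divides (vertical_line r) G.
Proof.
rewrite !divides_vertical_lineP rmorphM /= => /eqP; rewrite mulf_eq0.
by case/orP=> /eqP; [left|right].
Qed.

Lemma vertical_line_nonunit r : vertical_line r \isn't a GRing.unit.
Proof.
by rewrite poly_unitE size_polyC polyXsubC_eq0 /= coefC eqxx poly_unitE size_XsubC.
Qed.

Definition primitive (F : kxy) : Prop := forall r, ~ divides (vertical_line r) F.

Lemma nonconst_root (c : kx) : (1 < size c)%N ->
  exists r c', c = ('X - r%:P) * c' /\ size c = (size c').+1.
Proof.
move=> sc; have /closed_rootP [r rc] : size c != 1 by rewrite neq_ltn sc orbT.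
have [c' Ec] := factor_theorem _ _ rc; exists r, c'; split.
  by rewrite mulrC -Ec.
rewrite Ec size_Mmonic ?monicXsubC ?size_XsubC ?addn2 //.
by apply/eqP=> c0; move: sc; rewrite Ec c0 mul0r size_poly0.
Qed.

(** Gauss's lemma: the linear factors of c are prime and none divides P, so
  all of them can be cancelled. *)
Lemma primitive_divides (c : kx) (a P : kxy) :
  c != 0 -> primitive P -> divides P (c%:P * a) -> divides P a.
Proof.
move=> c0 prP; move: {2}(size c) (leqnn (size c)) => n.
elim: n c c0 => [c c0|n IHn c c0 sc [e Ee]].
  by rewrite leqn0 size_poly_eq0 (negPf c0).
have [s1|s1] := leqP (size c) 1.
  have uc : c%:P \is a GRing.unit.
    rewrite poly_unitE size_polyC c0 /= coefC eqxx poly_unitE.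
    have /eqP s1' : size c == 1 by rewrite eqn_leq s1 lt0n size_poly_eq0.
    have := c0; rewrite s1' eqxx /= (size1_polyC s1) polyC_eq0 coefC eqxx.
    by rewrite unitfE.
  exists (c%:P^-1 * e); rewrite mulrCA -Ee mulrA mulVr ?mul1r //.
have [r [c' [Ec Es]]] := nonconst_root s1.
have c'0 : c' != 0 by apply: contraNneq c0 => c'0; rewrite Ec c'0 mulr0.
have : divides (vertical_line r) (P * e).
  by rewrite -Ee Ec polyCM -mulrA; apply: divides_mulr; exists 1; rewrite mulr1.
case/vertical_line_prime => [/prP //|[e' Ee']].
apply: (IHn c'); rewrite ?c'0 //; first by rewrite -ltnS -Es.
exists e'; apply: (mulfI (vertical_line_neq0 r)).
by rewrite mulrA -polyCM -Ec Ee Ee' mulrCA.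
Qed.

Lemma lead_coef_vertical_line r (F : kxy) : F != 0 ->
  size (lead_coef (vertical_line r * F)) = (size (lead_coef F)).+1.
Proof.
move=> F0; rewrite lead_coefM lead_coefC mulrC size_Mmonic ?lead_coef_eq0 //.
  by rewrite size_XsubC addn2.
exact: monicXsubC.
Qed.

(** Linear factors are split off one by one; the degree in x of the leading
  coefficient in y decreases at each step. *)
Lemma primitive_part (F : kxy) : F != 0 ->
  exists (c : kx) (G : kxy), [/\ c != 0, primitive G & F = c%:P * G].
Proof.
move: {2}(size (lead_coef F)) (leqnn (size (lead_coef F))) => n.
elim: n F => [F|n IHn F sF F0].
  by rewrite leqn0 size_poly_eq0 lead_coef_eq0 => /eqP-> /eqP.
case: (classic (primitive F)) => [prF|/not_all_not_ex [r [G EF]]].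
  by exists 1, F; rewrite oner_neq0 mul1r.
have G0 : G != 0 by apply: contraNneq F0 => G0; rewrite EF G0 mulr0.
have [|//|c [H [c0 prH EG]]] := IHn G.
  by rewrite -ltnS -(lead_coef_vertical_line r) // -EF.
exists (('X - r%:P) * c), H; split=> //.
  by rewrite mulf_neq0 ?polyXsubC_eq0.
by rewrite EF EG polyCM mulrA.
Qed.

(** Pseudo-divisibility over k[x] is divisibility over k(x); for primitive
  divisors it agrees with true divisibility. *)
Lemma primitive_dvdp (P a : kxy) : primitive P -> P %| a -> divides P a.
Proof.
move=> prP; case/Pdiv.Idomain.dvdpP => [[c e] /= c0 Ee].
apply: (@primitive_divides c) => //.
by exists e; rewrite mul_polyC Ee mulrC.
Qed.

(** A common factor over k(x) has a primitive part dividing P and Q in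
  k[x][y], hence a unit; so P and Q are coprime over k(x), where Euclid's
  lemma holds. *)
Lemma primitive_euclid (P Q a b : kxy) :
  primitive P -> P != 0 -> coprime_elts P Q -> a * Q = b * P -> divides P a.
Proof.
move=> prP P0 cPQ EaQ.
have G0 : gcdp P Q != 0 by rewrite gcdp_eq0 negb_and P0.
have [c [G [c0 prG EG]]] := primitive_part G0.
have dG (F : kxy) : gcdp P Q %| F -> divides G F.
  move=> dF; apply: primitive_dvdp => //; apply: dvdp_trans dF.
  by rewrite EG dvdp_mull.
have uG : G \is a GRing.unit.
  by apply: cPQ; apply: dG; rewrite ?dvdp_gcdl ?dvdp_gcdr.
have cop : coprimep P Q.
  rewrite coprimep_def EG mul_polyC size_scale //.
  by move: uG; rewrite poly_unitE => /andP[].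
apply: primitive_dvdp => //.
by rewrite -(Gauss_dvdpl _ cop) EaQ dvdp_mull.
Qed.

(** The factors x - r of P do not divide Q, so they divide a and can be
  cancelled until P is primitive. *)
Lemma bivariate_euclid (P Q a b : kxy) :
  coprime_elts P Q -> a * Q = b * P -> divides P a.
Proof.
move: {2}(size (lead_coef P)) (leqnn (size (lead_coef P))) => n.
elim: n P a b => [P a b|n IHn P a b sP cPQ EaQ].
  rewrite leqn0 size_poly_eq0 lead_coef_eq0 => /eqP-> c0Q; rewrite mulr0 => E.
  have uQ : Q \is a GRing.unit.
    by apply: c0Q; [exists 0; rewrite mulr0|exists 1; rewrite mulr1].
  by exists 0; rewrite mulr0 -[a](mulrK uQ) E mul0r.
case: (eqVneq P 0) => [P0|P0].
  by apply: (IHn P a b) => //; rewrite P0 lead_coef0 size_poly0.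
case: (classic (primitive P)) => [prP|/not_all_not_ex [r [G EF]]].
  exact: primitive_euclid EaQ.
have G0 : G != 0 by apply: contraNneq P0 => G0; rewrite EF G0 mulr0.
have [|[a' Ea]|dQ] := @vertical_line_prime r a Q; first last.
- by have := vertical_line_nonunit r; rewrite cPQ //; exists G.
have [|||e Ee] := IHn G a' b.
- by rewrite -ltnS -(lead_coef_vertical_line r) // -EF.
- move=> e de; apply: cPQ; apply: divides_trans de _.
  by exists (vertical_line r); rewrite mulrC.
- apply: (mulfI (vertical_line_neq0 r)).
  by rewrite mulrA -Ea EaQ EF mulrCA.
  by exists e; rewrite EF Ea Ee mulrA.
by rewrite EaQ EF mulrC -mulrA; apply: divides_mulr; exists 1; rewrite mulr1.
Qed.

End Bivariate.

(** * Transport to polynomials in two variables *)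

Section Evaluation.
Variables (k : fieldType) (A : comNzRingType) (f : {rmorphism k -> A}).

Lemma comm_all (B : nzRingType) (g : B -> A) (u : A) : commr_rmorph g u.
Proof. by move=> c; apply: mulrC. Qed.

Definition eval1 (u : A) : {poly k} -> A := horner_morph (comm_all f u).
Definition eval2 (u v : A) : {poly {poly k}} -> A :=
  horner_morph (comm_all (eval1 u) v).

HB.instance Definition _ u := GRing.RMorphism.on (eval1 u).
HB.instance Definition _ u v := GRing.RMorphism.on (eval2 u v).

Lemma eval1C u c : eval1 u c%:P = f c.
Proof. exact: horner_morphC. Qed.

Lemma eval1X u : eval1 u 'X = u.
Proof. exact: horner_morphX. Qed.

Lemma eval2P u v c : eval2 u v c%:P = eval1 u c.
Proof. exact: horner_morphC. Qed.

Lemma eval2X u v : eval2 u v 'X%:P = u.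
Proof. by rewrite eval2P eval1X. Qed.

Lemma eval2Y u v : eval2 u v 'X = v.
Proof. exact: horner_morphX. Qed.

Lemma eval2C u v c : eval2 u v c%:P%:P = f c.
Proof. by rewrite eval2P eval1C. Qed.

Lemma rmorph_bivariate (B : comNzRingType) (g h : {rmorphism {mpoly k[2]} -> B}) :
  (forall c, g c%:MP = h c%:MP) -> (forall i, g 'X_i = h 'X_i) -> g =1 h.
Proof.
move=> ghC ghX F; rewrite (mpolyE F) !rmorph_sum /=; apply: eq_bigr => m _.
rewrite -mul_mpolyC !rmorphM ghC mpolyXE_id !rmorph_prod; congr (_ * _).
by apply: eq_bigr => i _; rewrite !rmorphXn /= ghX.
Qed.

End Evaluation.

Section Transport.
Variable k : fieldType.
Local Notation kx := {poly k}.

Definition to_bipoly : {mpoly k[2]} -> {poly {poly k}} :=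
  mmap (polyC \o polyC) (fun i : 'I_2 => if i == ord0 then 'X%:P else 'X).
HB.instance Definition _ := GRing.RMorphism.on to_bipoly.

Lemma to_bipolyC c : to_bipoly c%:MP = c%:P%:P. Proof. exact: mmapC. Qed.
Lemma to_bipolyX i : to_bipoly 'X_i = if i == ord0 then 'X%:P else 'X.
Proof. by rewrite /to_bipoly mmapX mmap1U. Qed.

Lemma mmap_eval2 (A : comNzRingType) (f : {rmorphism k -> A}) (h : 'I_2 -> A) F :
  mmap f h F = eval2 f (h ord0) (h ord_max) (to_bipoly F).
Proof.
apply: (@rmorph_bivariate k _ (mmap f h)
  (eval2 f (h ord0) (h ord_max) \o to_bipoly)).
  by move=> c /=; rewrite mmapC to_bipolyC eval2C.
move=> i /=; rewrite mmapX mmap1U to_bipolyX.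
case: eqP => [->|]; rewrite ?eval2X // eval2Y => /eqP i0; congr h.
by apply: val_inj; case: i i0 => [[|[]]].
Qed.

Definition of_bipoly : {poly {poly k}} -> {mpoly k[2]} :=
  eval2 (@mpolyC 2 k) 'X_ord0 'X_ord_max.
HB.instance Definition _ := GRing.RMorphism.on of_bipoly.

Lemma to_bipolyK : cancel to_bipoly of_bipoly.
Proof.
move=> F; rewrite /of_bipoly -(mmap_eval2 (@mpolyC 2 k) (fun i => 'X_i)).
rewrite -[RHS]comp_mpoly_id /comp_mpoly; apply: eq_bigr => m _.
by congr (_ * _); apply: eq_bigr => i _; rewrite tnth_mktuple.
Qed.

Lemma of_bipolyK : cancel of_bipoly to_bipoly.
Proof.
have C1 (c : kx) : to_bipoly (of_bipoly c%:P) = c%:P.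
  rewrite /of_bipoly eval2P.
  elim/poly_ind: c => [|c a IHc]; first by rewrite !rmorph0.
  rewrite 2!rmorphD 2!rmorphM /= IHc eval1X eval1C to_bipolyX.
  by rewrite eqxx to_bipolyC -polyCM -polyCD.
elim/poly_ind=> [|P c IHP]; first by rewrite !rmorph0.
by rewrite 2!rmorphD 2!rmorphM /= IHP C1 /of_bipoly eval2Y to_bipolyX.
Qed.

End Transport.

Lemma mpoly_euclid (k : closedFieldType) (P Q a b : {mpoly k[2]}) :
  coprime_elts P Q -> a * Q = b * P -> divides P a.
Proof.
move=> cPQ EaQ.
have [||e Ee] :=
  @bivariate_euclid k (to_bipoly P) (to_bipoly Q) (to_bipoly a) (to_bipoly b).
- move=> e [x Ex] [y Ey]; rewrite -(of_bipolyK e); apply: rmorph_unit; apply: cPQ.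
    by exists (of_bipoly x); rewrite -rmorphM -Ex /= to_bipolyK.
  by exists (of_bipoly y); rewrite -rmorphM -Ey /= to_bipolyK.
- by rewrite -!rmorphM EaQ.
by exists (of_bipoly e); rewrite -[P]to_bipolyK -rmorphM -Ee /= to_bipolyK.
Qed.

(** * Derivations and their extension to the fraction field *)

Section FractionField.
Import FracField.
Lemma frac_repr (R : idomainType) (z : {fraction R}) :
  z = (\n_(repr z))%:F / (\d_(repr z))%:F.
Proof.
have d0 : (\d_(repr z))%:F != 0 :> {fraction R} by rewrite tofrac_eq0 ?denom_ratioP.
apply: (canRL (mulfK d0)); rewrite -{1}[z]reprK.
move: (repr z) => x; unlock tofrac; rewrite -[LHS]pi_mul.
apply/eqmodP; rewrite /= equivfE /mulf.
rewrite !numden_Ratio ?mulf_neq0 ?oner_eq0 ?denom_ratioP //.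
by rewrite !mulr1 mulrC.
Qed.
End FractionField.

Section Derivations.
Variables (k : fieldType) (A : comNzRingType) (iota : {rmorphism k -> A}).
Variables (D : A -> A) (derD : is_derivation iota D).

Lemma der_add u v : D (u + v) = D u + D v. Proof. by case: derD. Qed.
Lemma der_scale c u : D (iota c * u) = iota c * D u. Proof. by case: derD. Qed.
Lemma der_mul u v : D (u * v) = D u * v + u * D v. Proof. by case: derD. Qed.

Lemma der_0 : D 0 = 0.
Proof. by apply: (addrI (D 0)); rewrite -der_add !addr0. Qed.

Lemma der_opp u : D (- u) = - D u.
Proof. by apply: (addrI (D u)); rewrite -der_add !subrr der_0. Qed.

Lemma der_sub u v : D (u - v) = D u - D v.
Proof. by rewrite der_add der_opp. Qed.

Lemma der_1 : D 1 = 0.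
Proof. by apply: (addrI (D 1)); rewrite addr0 -{3}[1]mulr1 der_mul mulr1 mul1r. Qed.

Lemma der_const c : D (iota c) = 0.
Proof. by rewrite -[iota c]mulr1 der_scale der_1 mulr0. Qed.

Lemma der_exp u n : D (u ^+ n) = u ^+ n.-1 *+ n * D u.
Proof.
elim: n => [|n IHn]; first by rewrite expr0 der_1 mulr0n mul0r.
rewrite exprS der_mul IHn /= mulrA mulrnAr [D u * _]mulrC.
case: n {IHn} => [|n]; first by rewrite !mulr0n mul0r addr0.
by rewrite -exprS -mulrDl -mulrS.
Qed.

Lemma der_horner (P : {poly A}) t :
  (forall i, D P`_i = 0) -> D P.[t] = P^`().[t] * D t.
Proof.
elim/poly_ind: P => [|P c IHP] DP; first by rewrite deriv0 !horner0 mul0r der_0.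
have DP' i : D P`_i = 0 by have := DP i.+1; rewrite -cons_poly_def coef_cons.
have Dc : D c = 0 by have := DP 0%N; rewrite -cons_poly_def coef_cons.
rewrite derivD derivM derivX derivC addr0 mulr1 !hornerE der_add der_mul Dc.
by rewrite IHP // addr0 mulrDl mulrAC.
Qed.

End Derivations.

(** Applying D to P(t) = 0 gives P'(t) D(t) = 0.  If P'(t) = 0, then the
  derivative P' is a relation of smaller degree, nonzero in characteristic
  zero. *)
Lemma der_algebraic (k F : fieldType) (iota : {rmorphism k -> F}) (D : F -> F)
    (P : {poly F}) (t : F) :
  is_derivation iota D -> [pchar F] =i pred0 -> P != 0 ->
  (forall i, D P`_i = 0) -> P.[t] = 0 -> D t = 0.
Proof.
move=> derD char0; move: {2}(size P) (leqnn (size P)) => n.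
elim: n P => [P|n IHn P sP P0 DP Pt].
  by rewrite leqn0 size_poly_eq0 => /eqP-> /eqP.
have [P't|P't] := eqVneq P^`().[t] 0; last first.
  apply/eqP; have := der_horner derD t DP; rewrite Pt (der_0 derD) => /esym/eqP.
  by rewrite mulf_eq0 (negPf P't).
have [s1|s1] := leqP (size P) 1.
  case/eqP: P0; move: Pt; rewrite (size1_polyC s1) hornerC => ->; exact: polyC0.
apply: (IHn P^`()) => //.
- by rewrite -ltnS (leq_trans _ sP) // lt_size_deriv.
- rewrite -size_poly_eq0 -lt0n.
  have : P^`()`_(size P).-2 != 0.
    rewrite coef_deriv prednK ?ltn_predRL // -mulr_natr mulf_neq0 //.
      by rewrite -lead_coefE lead_coef_eq0.
    by rewrite ((pcharf0P F).1 char0) -lt0n ltn_predRL.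
  by rewrite lt0n size_poly_eq0; apply: contraNneq => ->; rewrite coef0.
- move=> i; rewrite coef_deriv -mulr_natr (der_mul derD) DP mul0r add0r.
  have -> : i.+1%:R = iota i.+1%:R by rewrite rmorph_nat.
  by rewrite (der_const derD) mulr0.
Qed.

Lemma der_quotient (k F : fieldType) (iota : {rmorphism k -> F}) (D : F -> F) u v :
  is_derivation iota D -> v != 0 -> D u * v = u * D v -> D (u / v) = 0.
Proof.
move=> derD v0 E; have : D (u / v * v) = D u by rewrite divfK.
rewrite (der_mul derD) => E2; apply: (mulIf (mulf_neq0 v0 v0)).
rewrite mul0r mulrA.
have -> : D (u / v) * v = D u - u / v * D v by rewrite -E2 addrK.
by rewrite mulrBl E mulrAC divfK // subrr.
Qed.

Lemma der_quotient0 (k F : fieldType) (iota : {rmorphism k -> F}) (D : F -> F) u v :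
  is_derivation iota D -> v != 0 -> D (u / v) = 0 -> D u * v = u * D v.
Proof.
move=> derD v0 E; have <- : D (u / v * v) = D u by rewrite divfK.
by rewrite (der_mul derD) E mul0r add0r mulrAC divfK.
Qed.

Section QuotientRule.
Variable F : fieldType.
Implicit Types n d a b : F.

Lemma eq_div_cross n d n' d' : d != 0 -> d' != 0 ->
  n / d = n' / d' -> n * d' = n' * d.
Proof. by move=> d0 d'0 /eqP; rewrite eqr_div // => /eqP. Qed.

(** The derivative of n / d when n and d have derivatives a and b. *)
Definition quotient_rule n d a b : F := (a * d - n * b) / d ^+ 2.

Lemma quotient_rule_welldef n d a b n' d' a' b' : d != 0 -> d' != 0 ->
  n * d' = n' * d -> a * d' + n * b' = a' * d + n' * b ->
  quotient_rule n' d' a' b' = quotient_rule n d a b.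
Proof.
move=> d0 d'0 E DE; rewrite /quotient_rule.
have {}E : n' = n * d' / d by rewrite E mulfK.
have {}DE : a' = (a * d' + n * b' - n' * b) / d by rewrite DE addrK mulfK.
rewrite DE E; field; by rewrite d0 d'0.
Qed.

Lemma quotient_ruleM n d a b n' d' a' b' : d != 0 -> d' != 0 ->
  quotient_rule (n * n') (d * d') (a * n' + n * a') (b * d' + d * b') =
  quotient_rule n d a b * (n' / d') + n / d * quotient_rule n' d' a' b'.
Proof. move=> d0 d'0; rewrite /quotient_rule; field; by rewrite d0 d'0. Qed.

Lemma quotient_ruleD n d a b n' d' a' b' : d != 0 -> d' != 0 ->
  quotient_rule (n * d' + n' * d) (d * d')
    (a * d' + n * b' + (a' * d + n' * b)) (b * d' + d * b') =
  quotient_rule n d a b + quotient_rule n' d' a' b'.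
Proof. move=> d0 d'0; rewrite /quotient_rule; field; by rewrite d0 d'0. Qed.

End QuotientRule.

Section Extension.
Variables (R : idomainType) (D : R -> R).
Hypothesis DD : forall u v, D (u + v) = D u + D v.
Hypothesis DM : forall u v, D (u * v) = D u * v + u * D v.
Local Notation ratfun := {fraction R}.

(** The extension of D computed on a chosen representative; [frac_derE] shows
  that every representative gives the same value. *)
Definition frac_der (z : ratfun) : ratfun :=
  let n := \n_(repr z) in let d := \d_(repr z) in
  quotient_rule n%:F d%:F (D n)%:F (D d)%:F.

Lemma fracP (z : ratfun) : exists n d : R, d != 0 /\ z = n%:F / d%:F.
Proof.
by exists \n_(repr z), \d_(repr z); rewrite denom_ratioP -frac_repr.
Qed.

Lemma frac_derE (n d : R) : d != 0 ->
  frac_der (n%:F / d%:F) = quotient_rule n%:F d%:F (D n)%:F (D d)%:F.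
Proof.
move=> d0; rewrite /frac_der; set z := n%:F / d%:F.
have := frac_repr z; have := denom_ratioP (repr z).
move: (\n_(repr z)) (\d_(repr z)) => n1 d1 d10 Ez.
have d'0 : d%:F != 0 :> ratfun by rewrite tofrac_eq0.
have d1'0 : d1%:F != 0 :> ratfun by rewrite tofrac_eq0.
have E : n%:F * d1%:F = n1%:F * d%:F :> ratfun by apply: eq_div_cross.
apply: quotient_rule_welldef => //.
move: E; rewrite -!tofracM -!tofracD => /eqP; rewrite tofrac_eq => /eqP E.
by rewrite -!DM E.
Qed.

Lemma frac_der_poly (u : R) : frac_der u%:F = (D u)%:F.
Proof.
have D1 : D 1 = 0.
  by apply: (addrI (D 1)); rewrite addr0 -{3}[1]mulr1 DM mulr1 mul1r.
have := @frac_derE u 1 (oner_neq0 _).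
by rewrite /quotient_rule tofrac1 divr1 D1 tofrac0 mulr0 subr0 expr1n divr1 mulr1.
Qed.

Lemma frac_derM u v : frac_der (u * v) = frac_der u * v + u * frac_der v.
Proof.
have [n [d [d0 ->]]] := fracP u; have [n' [d' [d'0 ->]]] := fracP v.
rewrite mulf_div -!tofracM !frac_derE ?mulf_neq0 // !DM !(tofracD, tofracM).
by rewrite quotient_ruleM // tofrac_eq0.
Qed.

Lemma frac_derD u v : frac_der (u + v) = frac_der u + frac_der v.
Proof.
have [n [d [d0 ->]]] := fracP u; have [n' [d' [d'0 ->]]] := fracP v.
have d1 : d%:F != 0 :> ratfun by rewrite tofrac_eq0.
have d'1 : d'%:F != 0 :> ratfun by rewrite tofrac_eq0.
rewrite addf_div // -!tofracM -tofracD !frac_derE ?mulf_neq0 // !(DD, DM).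
by rewrite !(tofracD, tofracM) quotient_ruleD.
Qed.

End Extension.

Section RationalDerivations.
Variable k : fieldType.
Local Notation kxy := {mpoly k[2]}.
Local Notation ratfun := {fraction {mpoly k[2]}}.

HB.instance Definition _ :=
  GRing.RMorphism.copy (@ratconst k) (@FracField.tofrac kxy \o @mpolyC 2 k).
HB.instance Definition _ := GRing.RMorphism.copy (@polyconst k) (@mpolyC 2 k).

Lemma ratfun_pchar0 : [pchar k] =i pred0 -> [pchar ratfun] =i pred0.
Proof.
move=> /pcharf0P char0; apply/pcharf0P => n.
by rewrite -(rmorph_nat (@ratconst k)) fmorph_eq0 char0.
Qed.

Lemma der_kernel_subfield (D : ratfun -> ratfun) :
  is_derivation (@ratconst k) D -> is_subfield (fun u => D u = 0).
Proof.
move=> derD; split=> [c|u v Du Dv|u v Du Dv|u Du].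
- exact: (der_const derD).
- by rewrite (der_sub derD) Du Dv subrr.
- by rewrite (der_mul derD) Du Dv mul0r mulr0 addr0.
have [->|u0] := eqVneq u 0; first by rewrite invr0 (der_0 derD).
apply/eqP; have /eqP := der_mul derD u u^-1.
by rewrite mulfV // (der_1 derD) Du mul0r add0r eq_sym mulf_eq0 (negPf u0).
Qed.

Lemma frac_der_derivation (D : kxy -> kxy) :
  is_derivation (@polyconst k) D -> is_derivation (@ratconst k) (frac_der D).
Proof.
move=> derD; have DD := der_add derD; have DM := der_mul derD.
split=> [u v|c u|u v]; [exact: frac_derD| |exact: frac_derM].
rewrite frac_derM // /ratconst frac_der_poly // -/(polyconst c) (der_const derD).
by rewrite tofrac0 mul0r add0r.
Qed.

End RationalDerivations.

(** * Derivations of k[x,y] *)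

Section PolynomialDerivations.
Variable k : fieldType.
Local Notation kxy := {mpoly k[2]}.
Local Notation ratfun := {fraction {mpoly k[2]}}.

Lemma ord2P (i : 'I_2) : i = xvar \/ i = yvar.
Proof. by case: i => [[|[|i]] Hi] //; [left|right]; apply: val_inj. Qed.

Lemma mpoly_gen_ind (n : nat) (P : {mpoly k[n]} -> Prop) :
  (forall c, P c%:MP) -> (forall i, P 'X_i) ->
  (forall u v, P u -> P v -> P (u + v)) ->
  (forall u v, P u -> P v -> P (u * v)) -> forall u, P u.
Proof.
move=> PC PX PD PM u; rewrite (mpolyE u).
apply: (big_ind P); [by rewrite -mpolyC0|exact: PD|move=> m _].
rewrite -mul_mpolyC; apply: (PM _ _ (PC _)); rewrite mpolyXE_id.
apply: (big_ind P); [by rewrite -mpolyC1|exact: PM|move=> i _].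
elim: (m i) => [|e IHe]; first by rewrite expr0 -mpolyC1.
by rewrite exprS; apply: PM.
Qed.

Lemma gradient_derivation (P Q : kxy) :
  is_derivation (@polyconst k) (fun u => P * u^`M(xvar) + Q * u^`M(yvar)).
Proof.
split=> [u v|c u|u v];
  rewrite ?mderivD ?mderiv_mulC ?mderivM ?/polyconst; ring.
Qed.

Lemma mpoly_der_ext (D E : kxy -> kxy) :
  is_derivation (@polyconst k) D -> is_derivation (@polyconst k) E ->
  D 'X_xvar = E 'X_xvar -> D 'X_yvar = E 'X_yvar -> D =1 E.
Proof.
move=> derD derE EX EY; apply: mpoly_gen_ind => [c|i|u v Eu Ev|u v Eu Ev].
- by rewrite -/(polyconst c) (der_const derD) (der_const derE).
- by case: (ord2P i) => ->.
- by rewrite (der_add derD) (der_add derE) Eu Ev.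
- by rewrite (der_mul derD) (der_mul derE) Eu Ev.
Qed.

Lemma mderivXU (i j : 'I_2) : ('X_i : kxy)^`M(j) = (i == j)%:R.
Proof.
rewrite mderivX mnm1E; case: eqP => [->|_]; last by rewrite scale0r.
by rewrite -{1}[U_(j)%MM]add0m addmK mpolyX0 scale1r.
Qed.

Lemma mpoly_derE (D : kxy -> kxy) : is_derivation (@polyconst k) D ->
  forall u, D u = D 'X_xvar * u^`M(xvar) + D 'X_yvar * u^`M(yvar).
Proof.
move=> derD; apply: mpoly_der_ext => //; first exact: gradient_derivation.
  by rewrite !mderivXU eqxx mulr1 mulr0 addr0.
by rewrite !mderivXU eqxx mulr1 mulr0 add0r.
Qed.

Lemma mderiv_const (u : kxy) : [pchar k] =i pred0 ->
  u^`M(xvar) = 0 -> u^`M(yvar) = 0 -> u = (u@_0%MM)%:MP.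
Proof.
move=> /pcharf0P char0 ux uy; apply/mpolyP => m; rewrite mcoeffC.
have [->|m0] := eqVneq m 0%MM; first by rewrite mulr1.
rewrite mulr0.
have [i mi] : exists i, m i != 0%N.
  apply: not_all_not_ex => H; case/eqP: m0; apply/mnmP => i.
  by rewrite mnm0E; apply/eqP; apply/negPn/negP/H.
have ui : u^`M(i) = 0 by case: (ord2P i) => ->.
have Em : (m - U_(i) + U_(i))%MM = m.
  rewrite submK //; apply/mnm_lepP => j; rewrite mnm1E.
  by case: eqP => // <-; rewrite lt0n.
have := mcoeff_deriv i (m - U_(i))%MM u; rewrite ui mcoeff0 Em => /esym/eqP.
by rewrite -mulr_natr mulf_eq0 char0 orbF => /eqP.
Qed.

End PolynomialDerivations.

Section Bimonomials.

Definition bimon (n m : nat) : 'X_{1..2} :=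
  [multinom (if i == xvar then n else m) | i < 2].

Lemma mmap1_bimon (A : comNzRingType) (h : 'I_2 -> A) n m :
  mmap1 h (bimon n m) = h xvar ^+ n * h yvar ^+ m.
Proof.
rewrite /mmap1 big_ord_recl big_ord1 !mnmE.
by congr (_ * h _ ^+ _); apply: val_inj.
Qed.

Lemma bimon_eq n m n' m' : (bimon n m == bimon n' m') = ((n, m) == (n', m')).
Proof.
apply/eqP/eqP => [/mnmP E|[-> ->] //].
by move: (E xvar) (E yvar); rewrite !mnmE /= => -> ->.
Qed.

Lemma mdeg_bimon n m : mdeg (bimon n m) = (n + m)%N.
Proof. by rewrite mdegE big_ord_recl big_ord1 !mnmE. Qed.

Lemma bimonE (d : 'X_{1..2}) : d = bimon (d xvar) (d yvar).
Proof. by apply/mnmP => i; rewrite mnmE; case: (ord2P i) => ->. Qed.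

End Bimonomials.

(** * Three rational functions are algebraically dependent *)

Section Dependence.
Variable k : fieldType.
Local Notation kxy := {mpoly k[2]}.
Local Notation ratfun := {fraction {mpoly k[2]}}.

Lemma linear_dependence (I J : finType) (M : I -> J -> k) :
  (#|J| < #|I|)%N ->
  exists c : I -> k, (exists i, c i != 0) /\ forall j, \sum_i c i * M i j = 0.
Proof.
move=> ltJI; pose A := \matrix_(i < #|I|, j < #|J|) M (enum_val i) (enum_val j).
have : kermx A != 0.
  rewrite kermx_eq0 /row_free neq_ltn.
  by rewrite (leq_ltn_trans (rank_leq_col A)).
case/rowV0Pn => v /sub_kermxP vA v0; exists (fun i => v 0 (enum_rank i)); split.
  case/rV0Pn: v0 => j vj; exists (enum_val j); by rewrite enum_valK.
move=> j; have /rowP/(_ (enum_rank j)) := vA; rewrite !mxE => vAj.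
rewrite -[RHS]vAj.
rewrite (reindex (@enum_val I predT)) /=; last first.
  by exists enum_rank => i _; rewrite ?enum_valK ?enum_rankK.
by apply: eq_bigr => i _; rewrite enum_valK !mxE enum_rankK.
Qed.

(** Polynomials of degree less than M lie in a space of dimension at most
  M ^ 2. *)
Lemma mpoly_dependence (I : finType) (P : I -> kxy) (M : nat) :
  (forall i, (msize (P i) <= M)%N) -> (M ^ 2 < #|I|)%N ->
  exists c : I -> k, (exists i, c i != 0) /\ \sum_i c i *: P i = 0.
Proof.
move=> sP ltMI.
have [|c [c0 Ec]] := @linear_dependence I ('I_M * 'I_M)%type
  (fun i j => (P i)@_(bimon j.1 j.2)).
  by rewrite card_prod !card_ord mulnn.
exists c; split=> //; apply/mpolyP => m; rewrite mcoeff0 raddf_sum /=.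
have dm : mdeg m = (m xvar + m yvar)%N by rewrite [in LHS](bimonE m) mdeg_bimon.
have [sm|sm] := leqP M (mdeg m).
  rewrite big1 // => i _; rewrite mcoeffZ memN_msupp_eq0 ?mulr0 //.
  by apply: msize_mdeg_ge; apply: leq_trans sm.
have hx : (m xvar < M)%N by apply: leq_ltn_trans sm; rewrite dm leq_addr.
have hy : (m yvar < M)%N by apply: leq_ltn_trans sm; rewrite dm leq_addl.
rewrite -[RHS](Ec (Ordinal hx, Ordinal hy)); apply: eq_bigr => i _; rewrite mcoeffZ.
by rewrite [in LHS](bimonE m).
Qed.

(** Total degree; unlike [msize] it is subadditive, also at 0. *)
Definition mdegree (u : kxy) := (msize u).-1.

Lemma mdegreeM (u v : kxy) : (mdegree (u * v) <= mdegree u + mdegree v)%N.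
Proof.
have [->|u0] := eqVneq u 0; first by rewrite mul0r /mdegree msize0.
have [->|v0] := eqVneq v 0; first by rewrite mulr0 /mdegree msize0.
rewrite /mdegree msizeM //; move: u0 v0; rewrite -!msize_poly_eq0 -!lt0n.
by case: (msize u) (msize v) => [//|a] [//|b] _ _; rewrite addSn addnS.
Qed.

Lemma mdegreeX (u : kxy) n : (mdegree (u ^+ n) <= n * mdegree u)%N.
Proof.
elim: n => [|n IHn]; first by rewrite expr0 /mdegree msize1.
by rewrite exprS mulSn (leq_trans (mdegreeM _ _)) // leq_add2l.
Qed.

(** A relation between a / c, b / c and w, cleared of denominators: the N ^ 3
  products have degree at most 3 N e, hence lie in a space of dimension about
  (3 N e) ^ 2, too small for large N. *)
Lemma trivariate_dependence (a b c w : kxy) : exists (N : nat)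
    (C : 'I_N * 'I_N * 'I_N -> k), (exists t, C t != 0) /\
  \sum_t C t *: (a ^+ t.1.1 * b ^+ t.1.2 *
    c ^+ (2 * N - t.1.1 - t.1.2) * w ^+ t.2) = 0.
Proof.
pose e := (mdegree a + mdegree b + mdegree c + mdegree w).+1.
(* N ^ 3 exceeds (4 e N) ^ 2 as soon as N > 16 e ^ 2. *)
pose N := (16 * e ^ 2).+1; exists N.
apply: (@mpoly_dependence _ _ (4 * e * N)%N) => [[[i j] l] /=|]; last first.
  rewrite !card_prod !card_ord !expnMn mulnA -mulnA mulnn [X in (_ < X)%N]mulnC.
  by rewrite -expnS expnS ltn_pmul2r ?expn_gt0.
have le_e u : (mdegree u <= mdegree a + mdegree b + mdegree c + mdegree w)%N ->
    forall n, (mdegree (u ^+ n) <= n * e)%N.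
  by move=> le n; rewrite (leq_trans (mdegreeX _ _)) // leq_mul2l (leqW le) orbT.
have : (mdegree (a ^+ i * b ^+ j * c ^+ (2 * N - i - j) * w ^+ l) <= 3 * N * e)%N.
  apply: leq_trans (mdegreeM _ _) _.
  apply: (@leq_trans (((i + j + (2 * N - i - j)) + l) * e)%N); last first.
    rewrite leq_mul2r; apply/orP; right; rewrite -subnDA subnKC; last first.
      by rewrite mul2n -addnn leq_add // ltnW.
    by rewrite (mulnDl 2 1) mul1n leq_add2l ltnW.
  rewrite mulnDl leq_add ?le_e ?leq_addl //.
  apply: leq_trans (mdegreeM _ _) _; rewrite mulnDl leq_add ?le_e //; last first.
    by rewrite -addnA addnC -addnA leq_addr.
  apply: leq_trans (mdegreeM _ _) _; rewrite mulnDl leq_add ?le_e //.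
    by rewrite -!addnA leq_addr.
  by rewrite -!addnA addnCA leq_addr.
rewrite /mdegree => H; apply: leq_trans (leqSpred _) _.
apply: (@leq_ltn_trans (3 * N * e)%N); first exact: H.
rewrite mulnAC ltn_pmul2r // ltn_pmul2r //.
Qed.

End Dependence.

(** * Kernels of derivations of k(x,y) *)

Lemma clear_powers (F : fieldType) (a b c : F) i j e : c != 0 ->
  c ^+ (e + (i + j)) * ((a / c) ^+ i * (b / c) ^+ j) = a ^+ i * b ^+ j * c ^+ e.
Proof.
move=> c0; rewrite !expr_div_n mulf_div -exprD [c ^+ (e + _)]exprD -mulrA.
by rewrite [X in _ * X]mulrC divfK ?expf_neq0 // mulrC.
Qed.

Section KernelTranscendence.
Variable k : fieldType.
Local Notation kxy := {mpoly k[2]}.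
Local Notation ratfun := {fraction {mpoly k[2]}}.
Hypothesis char0 : [pchar k] =i pred0.
Variables (D : ratfun -> ratfun) (derD : is_derivation (@ratconst k) D).

Lemma der_mmap0 (n : nat) (h : 'I_n -> ratfun) (F : {mpoly k[n]}) :
  (forall i, D (h i) = 0) -> D (mmap (@ratconst k) h F) = 0.
Proof.
move=> Dh; move: F; apply: mpoly_gen_ind => [c|i|u v Du Dv|u v Du Dv].
- by rewrite mmapC (der_const derD).
- by rewrite mmapX mmap1U.
- by rewrite mmapD (der_add derD) Du Dv addr0.
by rewrite rmorphM (der_mul derD) /= Du Dv mul0r mulr0 addr0.
Qed.

Lemma common_denominator (u v : ratfun) :
  exists a b c : kxy, [/\ c != 0, u = a%:F / c%:F & v = b%:F / c%:F].
Proof.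
have [n [d [d0 ->]]] := fracP u; have [n' [d' [d'0 ->]]] := fracP v.
exists (n * d'), (n' * d), (d * d'); split; first by rewrite mulf_neq0.
  by rewrite !tofracM -mulf_div divff ?mulr1 ?tofrac_eq0.
by rewrite !tofracM [d%:F * _]mulrC -mulf_div divff ?mulr1 ?tofrac_eq0.
Qed.

(** A relation between u, v (the values of h) and w, read as a polynomial in w,
  is nonzero because u and v are independent, and its coefficients are killed by D; so
  [der_algebraic] applies to w. *)
Lemma der_indep_eq0 (h : 'I_2 -> ratfun) :
  (forall i, D (h i) = 0) -> alg_independent (@ratconst k) h ->
  forall w : kxy, D w%:F = 0.
Proof.
move=> Dh indep w.
have [a [b [c [c0 Eu Ev]]]] := common_denominator (h xvar) (h yvar).
have c'0 : c%:F != 0 :> ratfun by rewrite tofrac_eq0.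
(* C collects the coefficients of a relation of degree less than N in each of
   u, v and w; G l is the coefficient of w ^ l. *)
have [N [C [[[[i0 j0] l0] C0] EC]]] := trivariate_dependence a b c w.
pose G (l : 'I_N) : kxy :=
  \sum_(ij : 'I_N * 'I_N) C (ij, l) *: 'X_[bimon ij.1 ij.2].
have G0 : G l0 != 0.
  suff : (G l0)@_(bimon i0 j0) = C (i0, j0, l0).
    by move=> E; apply: contraNneq C0 => Gl; rewrite -E Gl mcoeff0.
  rewrite raddf_sum /= (bigD1 (i0, j0)) //= mcoeffZ mcoeffX eqxx mulr1.
  rewrite big1 ?addr0 // => [[i j]] /= ne; rewrite mcoeffZ mcoeffX bimon_eq.
  case: eqP => [[] /ord_inj Ei /ord_inj Ej|_]; last by rewrite mulr0.
  by rewrite Ei Ej eqxx in ne.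
pose g l := mmap (@ratconst k) h (G l).
have gE l : g l = \sum_(ij : 'I_N * 'I_N)
    ratconst (C (ij, l)) * (h xvar ^+ ij.1 * h yvar ^+ ij.2).
  rewrite /g rmorph_sum /=; apply: eq_bigr => ij _.
  by rewrite mmapZ mmapX mmap1_bimon.
have g0 : g l0 != 0 by apply: contraNneq G0 => /indep ->.
pose P : {poly ratfun} := \poly_(l < N) (if insub l is Some l' then g l' else 0).
have PE (l : 'I_N) : P`_l = g l by rewrite coef_poly ltn_ord valK.
apply: (@der_algebraic k _ (@ratconst k) D P) => //.
- exact: ratfun_pchar0.
- by apply: contraNneq g0 => P0; rewrite -PE P0 coef0.
- move=> l; have [lN|lN] := ltnP l N.
    by rewrite (PE (Ordinal lN)) der_mmap0.
  by rewrite coef_poly ltnNge lN (der_0 derD).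
rewrite horner_poly; apply: (mulfI (expf_neq0 (2 * N) c'0)); rewrite mulr0.
transitivity ((\sum_t C t *: (a ^+ t.1.1 * b ^+ t.1.2 *
    c ^+ (2 * N - t.1.1 - t.1.2) * w ^+ t.2))%:F : ratfun); last first.
  by rewrite EC tofrac0.
pose T (ij : 'I_N * 'I_N) (l : 'I_N) := ratconst (C (ij, l)) *
  (c%:F ^+ (2 * N) * (h xvar ^+ ij.1 * h yvar ^+ ij.2) * w%:F ^+ l).
transitivity (\sum_(l < N) \sum_ij T ij l).
  rewrite mulr_sumr; apply: eq_bigr => l _; rewrite valK gE mulr_suml mulr_sumr.
  by apply: eq_bigr => ij _; rewrite /T !mulrA [_ * ratconst _]mulrC.
rewrite exchange_big pair_bigA rmorph_sum /=; apply: eq_bigr => [[[i j] l]] _ /=.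
rewrite -mul_mpolyC !rmorphM /= !rmorphXn /=; congr (_ * (_ * _)).
rewrite Eu Ev.
rewrite -[RHS](clear_powers a%:F b%:F i j (2 * N - i - j) c'0).
by rewrite -subnDA subnK // mul2n -addnn leq_add // ltnW.
Qed.

End KernelTranscendence.

(** The renaming of variables along s has a left inverse that sends the other
  variables to 0, so it preserves nonzero relations. *)
Lemma alg_independent_sub (k : fieldType) (A : comNzRingType)
    (f : {rmorphism k -> A}) n m (s : 'I_n -> 'I_m) (u : 'I_m -> A) :
  injective s -> alg_independent f u -> alg_independent f (u \o s).
Proof.
move=> sI indep F F0.
pose up : {mpoly k[n]} -> {mpoly k[m]} := mmap (@mpolyC m k) (fun i => 'X_(s i)).
pose down : {mpoly k[m]} -> {mpoly k[n]} :=
  mmap (@mpolyC n k) (fun j => if [pick i | s i == j] is Some i then 'X_i else 0).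
have upK G : down (up G) = G.
  move: G; apply: mpoly_gen_ind => [c|i|G H EG EH|G H EG EH].
  - by rewrite /up mmapC /down mmapC.
  - rewrite /up mmapX mmap1U /down mmapX mmap1U; case: pickP => [j /eqP/sI -> //|].
    by move/(_ i); rewrite eqxx.
  - by rewrite /up mmapD /down mmapD; congr (_ + _).
  by rewrite /up rmorphM /down rmorphM; congr (_ * _).
have upE G : mmap f u (up G) = mmap f (u \o s) G.
  move: G; apply: mpoly_gen_ind => [c|i|G H EG EH|G H EG EH].
  - by rewrite /up !mmapC.
  - by rewrite /up !mmapX !mmap1U mmapX mmap1U.
  - by rewrite /up !mmapD; congr (_ + _).
  by rewrite /up !rmorphM; congr (_ * _).
by rewrite -[F]upK (indep (up F)) ?upE // /down mmap0.
Qed.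

Section GenerativeKernel.
Variable k : closedFieldType.
Local Notation kxy := {mpoly k[2]}.
Local Notation ratfun := {fraction {mpoly k[2]}}.
Hypothesis char0 : [pchar k] =i pred0.
Variables (D : ratfun -> ratfun) (derD : is_derivation (@ratconst k) D).

Lemma der_kernel_trdeg m (u : 'I_m -> ratfun) (w : kxy) : D w%:F <> 0 ->
  (forall i, D (u i) = 0) -> alg_independent (@ratconst k) u -> (m <= 1)%N.
Proof.
move=> Dw Du indep; rewrite leqNgt; apply/negP => m2; apply: Dw.
pose s (i : 'I_2) := widen_ord m2 i.
apply: (@der_indep_eq0 k char0 D derD (u \o s)) => [i|]; first exact: Du.
by apply: alg_independent_sub => // i j /(congr1 val) /= E; apply: val_inj.
Qed.

Lemma der_adjoin (g u : ratfun) : D g = 0 -> adjoin g u -> D u = 0.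
Proof.
move=> Dg /(_ (fun v => D v = 0)); apply=> //.
exact: der_kernel_subfield.
Qed.

(** The kernel of D is a subfield of transcendence degree 1 that contains k(g),
  so it is k(g) by maximality. *)
Lemma der_kernel_generative (phi g : ratfun) (w : kxy) :
  generative phi g -> D w%:F <> 0 -> D g = 0 ->
  forall u, D u = 0 -> adjoin g u.
Proof.
move=> [[_ [[v [vK vindep]] _] phiK] maxK] Dw Dg.
apply: (maxK (fun u => D u = 0)); last by move=> u; apply: der_adjoin.
split; first exact: der_kernel_subfield.
- split; last by move=> m u; apply: der_kernel_trdeg Dw.
  by exists v; split=> // i; apply: der_adjoin (vK i).
- exact: der_adjoin phiK.
Qed.

(** Over an algebraically closed field a relation for phi splits into factors
  phi - a. *)
Lemma nonconst_transcendental (phi : ratfun) (c : {poly k}) :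
  (forall a, phi <> ratconst a) -> c != 0 -> eval1 (@ratconst k) phi c != 0.
Proof.
move=> phiN c0; have [r Ec] := closed_field_poly_normal c.
rewrite Ec -mul_polyC rmorphM rmorph_prod mulf_neq0 //=.
  by rewrite eval1C fmorph_eq0 lead_coef_eq0.
rewrite prodf_seq_neq0; apply/allP => a _ /=; rewrite rmorphB /= eval1X eval1C.
by rewrite subr_eq0; apply/eqP/phiN.
Qed.

(** The field k(g) has transcendence degree 1 and contains the transcendental
  element phi, so g is algebraic over k(phi), a field killed by D. *)
Lemma der_generative (phi g : ratfun) :
  (forall a, phi <> ratconst a) -> generative phi g -> D phi = 0 -> D g = 0.
Proof.
move=> phiN [[_ [_ le1] phiK] _] Dphi.
pose h (i : 'I_2) := if i == xvar then phi else g.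
have [F F0] : exists F, ~ (mmap (@ratconst k) h F = 0 -> F = 0).
  apply: not_all_ex_not => indep; suff: (2 <= 1)%N by [].
  apply: (le1 2 h) => // i; rewrite /h; case: eqP => // _; by move=> K.
have {F0} [Fh /eqP F0] : mmap (@ratconst k) h F = 0 /\ F <> 0.
  by apply: NNPP => H; apply: F0 => Fh; apply: NNPP => F0; apply: H.
pose P := map_poly (eval1 (@ratconst k) phi) (to_bipoly F).
have Pi i : P`_i = eval1 (@ratconst k) phi (to_bipoly F)`_i by rewrite coef_map.
apply: (@der_algebraic k _ (@ratconst k) D P) => //.
- exact: ratfun_pchar0.
- have : to_bipoly F != 0.
    by apply: contraNneq F0 => F0; rewrite -[F]to_bipolyK F0 /of_bipoly rmorph0.
  rewrite -lead_coef_eq0 lead_coefE => /(nonconst_transcendental phiN).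
  by rewrite -Pi; apply: contraNneq => ->; rewrite coef0.
- move=> i; rewrite Pi /eval1 /horner_morph (der_horner derD) ?Dphi ?mulr0 // => j.
  by rewrite coef_map /= (der_const derD).
by rewrite -Fh mmap_eval2.
Qed.

End GenerativeKernel.

(** * Forms in p and q *)

Section Forms.
Variables (k : fieldType) (p q : {mpoly k[2]}).
Local Notation kxy := {mpoly k[2]}.
Local Notation ratfun := {fraction {mpoly k[2]}}.

(** The homogenization of P to degree m, evaluated at p and q: factoring forms
  becomes factoring polynomials in one variable. *)
Definition form (m : nat) (P : {poly k}) : kxy :=
  \sum_(i < m.+1) P`_i *: (p ^+ i * q ^+ (m - i)).

Lemma comp_bimon n m : 'X_[bimon n m] \mPo [tuple p; q] = p ^+ n * q ^+ m.
Proof. by rewrite /comp_mpoly mmapX mmap1_bimon /tnth. Qed.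

Lemma pq_homogP m g :
  pq_homog p q m g <-> exists2 P : {poly k}, (size P <= m.+1)%N & g = form m P.
Proof.
split=> [[F Fm ->]|[P sP ->]]; last first.
  exists (\sum_(i < m.+1) P`_i *: 'X_[bimon i (m - i)]); last first.
    rewrite rmorph_sum /=; apply: eq_bigr => i _.
    by rewrite comp_mpolyZ comp_bimon.
  apply: rpred_sum => i _; apply: rpredZ.
  by rewrite dhomogX /= mdeg_bimon subnKC // -ltnS.
exists (\poly_(i < m.+1) F@_(bimon i (m - i))); first exact: size_poly.
have EF : F = \sum_(i < m.+1) F@_(bimon i (m - i)) *: 'X_[bimon i (m - i)].
  apply/mpolyP => d; rewrite raddf_sum /=.
  have dd : mdeg d = (d xvar + d yvar)%N by rewrite [in LHS](bimonE d) mdeg_bimon.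
  have [dm|dm] := eqVneq (mdeg d) m; last first.
    rewrite (dhomog_nemf_coeff Fm dm) big1 // => i _; rewrite mcoeffZ mcoeffX.
    case: eqP => [E|_]; last by rewrite mulr0.
    by rewrite -E mdeg_bimon subnKC ?eqxx // -ltnS in dm.
  have hx : (d xvar < m.+1)%N by rewrite ltnS -dm dd leq_addr.
  have Ed : d = bimon (d xvar) (m - d xvar).
    apply/mnmP => i; rewrite mnmE; case: (ord2P i) => -> //=.
    by rewrite -dm dd addKn.
  rewrite (bigD1 (Ordinal hx)) //= mcoeffZ mcoeffX -Ed eqxx mulr1 big1 ?addr0 //.
  move=> i ne; rewrite mcoeffZ mcoeffX Ed bimon_eq.
  case: eqP => [[Ei _]|_]; last by rewrite mulr0.
  by case/eqP: ne; apply: val_inj.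
rewrite {1}EF rmorph_sum /form /=; apply: eq_bigr => i _.
by rewrite comp_mpolyZ comp_bimon coef_poly ltn_ord.
Qed.

Lemma pq_homog0 m : pq_homog p q m 0.
Proof. by exists 0; rewrite ?dhomog0 ?comp_mpoly0. Qed.

Lemma pq_homog1 : pq_homog p q 0 1.
Proof. by exists 1; rewrite ?dhomog1 ?comp_mpoly1. Qed.

Lemma pq_homogD m f g :
  pq_homog p q m f -> pq_homog p q m g -> pq_homog p q m (f + g).
Proof.
by case=> F Fm -> [G Gm ->]; exists (F + G); rewrite ?dhomogD ?comp_mpolyD.
Qed.

Lemma pq_homogZ m c f : pq_homog p q m f -> pq_homog p q m (c *: f).
Proof. by case=> F Fm ->; exists (c *: F); rewrite ?dhomogZ ?comp_mpolyZ. Qed.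

Lemma pq_homogB m f g :
  pq_homog p q m f -> pq_homog p q m g -> pq_homog p q m (f - g).
Proof. by move=> hf hg; rewrite -scaleN1r; apply/pq_homogD/pq_homogZ. Qed.

Lemma pq_homogM m n f g :
  pq_homog p q m f -> pq_homog p q n g -> pq_homog p q (m + n) (f * g).
Proof.
by case=> F Fm -> [G Gm ->]; exists (F * G); rewrite ?dhomogM // rmorphM.
Qed.

Lemma pq_homogpq i j : pq_homog p q (i + j) (p ^+ i * q ^+ j).
Proof. by exists 'X_[bimon i j]; rewrite ?dhomogX ?comp_bimon /= ?mdeg_bimon. Qed.

Lemma pq_homog_p : pq_homog p q 1 p.
Proof. by have := pq_homogpq 1 0; rewrite expr1 mulr1. Qed.

Lemma pq_homog_q : pq_homog p q 1 q.
Proof. by have := pq_homogpq 0 1; rewrite expr1 mul1r. Qed.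

Lemma pq_homog_const c : pq_homog p q 0 c%:MP.
Proof. by rewrite -[_%:MP]mulr1 mul_mpolyC; apply/pq_homogZ/pq_homog1. Qed.

Lemma pq_homog_0P g : pq_homog p q 0 g -> exists c, g = c%:MP.
Proof.
case/pq_homogP=> P _ ->; exists P`_0.
by rewrite /form big_ord1 /= mulr1 -mul_mpolyC mulr1.
Qed.

(** The quotients of forms of equal degree make up a subfield. *)
Lemma adjoin_homog u : q != 0 -> adjoin (p%:F / q%:F) u ->
  exists m (A B : kxy),
    [/\ pq_homog p q m A, pq_homog p q m B, B != 0 & u = A%:F / B%:F].
Proof.
move=> q0 adj; apply: (adj (fun u => exists m (A B : kxy),
    [/\ pq_homog p q m A, pq_homog p q m B, B != 0 & u = A%:F / B%:F])); last first.
  by exists 1%N, p, q; split=> //; [apply: pq_homog_p|apply: pq_homog_q].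
split=> [c|v w|v w|v].
- exists 0%N, c%:MP, 1; split; rewrite ?oner_neq0 ?tofrac1 ?divr1 //.
    exact: pq_homog_const.
  exact: pq_homog1.
- case=> [m [A [B [hA hB B0 ->]]]] [n [A' [B' [hA' hB' B'0 ->]]]].
  exists (m + n)%N, (A * B' - A' * B), (B * B'); split.
  + by apply: pq_homogB; [|rewrite addnC]; apply: pq_homogM.
  + exact: pq_homogM.
  + by rewrite mulf_neq0.
  by rewrite tofracB !tofracM -mulNr addf_div ?mulNr // tofrac_eq0.
- case=> [m [A [B [hA hB B0 ->]]]] [n [A' [B' [hA' hB' B'0 ->]]]].
  exists (m + n)%N, (A * A'), (B * B'); split; try exact: pq_homogM.
    by rewrite mulf_neq0.
  by rewrite !tofracM mulf_div.
case=> [m [A [B [hA hB B0 ->]]]]; have [A0|A0] := eqVneq A 0.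
  by exists m, A, B; split=> //; rewrite A0 tofrac0 mul0r invr0.
by exists m, B, A; split=> //; rewrite invf_div.
Qed.

Lemma formD m P Q : form m (P + Q) = form m P + form m Q.
Proof.
rewrite /form -big_split; apply: eq_bigr => i _ /=.
by rewrite coefD scalerDl.
Qed.

Lemma formZ m c P : form m (c *: P) = c *: form m P.
Proof.
by rewrite /form scaler_sumr; apply: eq_bigr => i _; rewrite coefZ scalerA.
Qed.

Lemma form_recr m P : form m.+1 P = q * form m P + P`_m.+1 *: p ^+ m.+1.
Proof.
rewrite /form big_ord_recr /= subnn mulr1 mulr_sumr; congr (_ + _).
apply: eq_bigr => i _ /=; rewrite subSn -1?ltnS // exprS -scalerAr.
by congr (_ *: _); rewrite mulrCA.
Qed.

Lemma formX m P : form m.+1 ('X * P) = p * form m P.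
Proof.
rewrite /form big_ord_recl coefXM eqxx scale0r add0r mulr_sumr.
apply: eq_bigr => i _; rewrite coefXM /= /bump /= add1n subSS exprS -scalerAr.
by rewrite -mulrA.
Qed.

Lemma formC m c : form m c%:P = c *: q ^+ m.
Proof.
rewrite /form big_ord_recl big1 => [|i _]; last by rewrite coefC scale0r.
by rewrite coefC addr0 mul1r subn0.
Qed.

(** Division with remainder by the linear form p - r q. *)
Lemma form_divide m r (P : {poly k}) c : (size P <= m.+1)%N ->
  form m.+1 (('X - r%:P) * P + c%:P) = (p - r *: q) * form m P + c *: q ^+ m.+1.
Proof.
move=> sP; rewrite formD formC mulrBl mul_polyC -scaleNr formD formX formZ.
by rewrite form_recr nth_default // scale0r addr0 scaleNr mulrBl scalerAl.
Qed.

Definition pq_line (l : kxy) := l = q \/ exists r, l = p - r *: q.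

Lemma pq_line_homog l : pq_line l -> pq_homog p q 1 l.
Proof.
case=> [->|[r ->]]; first exact: pq_homog_q.
by apply: pq_homogB; [apply: pq_homog_p|apply/pq_homogZ/pq_homog_q].
Qed.

End Forms.

(** * Divisibility by forms *)

Section PQFree.
Variables (k : closedFieldType) (p q : {mpoly k[2]}).
Local Notation kxy := {mpoly k[2]}.

(** Either the dehomogenized form has lower degree than expected, and q is a
  factor, or it has a root r, and p - r q is one. *)
Lemma pq_homog_line_factor m B : pq_homog p q m.+1 B ->
  exists l B', [/\ pq_line p q l, pq_homog p q m B' & B = l * B'].
Proof.
case/pq_homogP => P sP ->; have [sP'|sP'] := leqP (size P) m.+1.
  exists q, (form p q m P); split; first by left.
    by apply/pq_homogP; exists P.
  by rewrite form_recr nth_default // scale0r addr0.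
have [r [P' [EP sPP']]] := nonconst_root (leq_trans (ltnS _ _ : (1 < m.+2)%N) sP').
have sP'm : (size P' <= m.+1)%N by rewrite -ltnS -sPP'.
exists (p - r *: q), (form p q m P'); split; first by right; exists r.
  by apply/pq_homogP; exists P'.
by rewrite EP -[_ * P']addr0 form_divide // scale0r addr0.
Qed.

Hypothesis cpq : coprime_elts p q.

Lemma coprime_divides_exp (a b c : kxy) n :
  coprime_elts a b -> divides a (c * b ^+ n) -> divides a c.
Proof.
move=> cab; elim: n => [|n IHn]; first by rewrite mulr1.
rewrite exprSr mulrA => [[x Ex]]; apply: IHn.
by apply: (mpoly_euclid cab) (_ : _ = x * a); rewrite Ex mulrC.
Qed.

(** Write H = l H' + c b ^ m.+1 by division, with b one of p, q and coprime to
  l.  If c were nonzero, then l would divide fbar b ^ m.+1, hence fbar. *)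
Lemma pq_free_line_divides m l fbar H :
  pq_free p q fbar -> pq_line p q l -> pq_homog p q m.+1 H ->
  divides l (fbar * H) -> exists2 H', pq_homog p q m H' & H = l * H'.
Proof.
move=> fr ll hH dl.
suff key b c H' : coprime_elts l b -> pq_homog p q m H' ->
    H = l * H' + c *: b ^+ m.+1 -> exists2 H', pq_homog p q m H' & H = l * H'.
  case/pq_homogP: hH dl key => P sP -> dl key.
  case: ll dl key => [->|[r ->]] dl key.
    apply: (key p P`_m.+1 (form p q m P)); first exact: coprime_elts_sym.
      apply/pq_homogP; exists (\poly_(i < m.+1) P`_i); first exact: size_poly.
      by apply: eq_bigr => i _; rewrite coef_poly ltn_ord.
    exact: form_recr.
  pose P' := P %/ ('X - r%:P).
  have sP' : (size P' <= m.+1)%N.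
    by rewrite size_divp ?polyXsubC_eq0 // size_XsubC leq_subLR add1n.
  apply: (key q P.[r] (form p q m P')).
  - move=> e [x Ex] [y Ey]; apply: cpq; last by exists y.
    exists (x + r *: y); rewrite mulrDr -Ex -scalerAr -Ey subrK //.
  - by apply/pq_homogP; exists P'.
  rewrite -form_divide //; congr form.
  by rewrite {1}(divp_eq P ('X - r%:P)) modp_XsubC mulrC.
move=> clb hH' EH; exists H' => //.
have [c0|c0] := eqVneq c 0; first by rewrite EH c0 scale0r addr0.
case: (fr 1%N l) => //; first exact: pq_line_homog.
apply: (coprime_divides_exp clb (n := m.+1)).
have [x Ex] := dl; exists (c^-1 *: (x - fbar * H')).
rewrite -scalerAr mulrBr -Ex EH; apply: (scalerI c0).
rewrite scalerA divff // scale1r [l * (_ * _)]mulrCA -mulrBr addrAC subrr add0r.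
by rewrite scalerAr.
Qed.

(** The linear factors of B are cancelled one at a time against H. *)
Lemma pq_free_quotient n m fbar H B g :
  pq_free p q fbar -> pq_homog p q (m + n) H -> pq_homog p q n B -> B != 0 ->
  fbar * H = g * B -> exists2 h, pq_homog p q m h & g = fbar * h.
Proof.
move=> fr; elim: n H B => [|n IHn] H B hH hB B0 E.
  have [c Ec] := pq_homog_0P hB; rewrite addn0 in hH.
  have c0 : c != 0 by apply: contraNneq B0 => c0; rewrite Ec c0 mpolyC0.
  exists (c^-1 *: H); first exact: pq_homogZ.
  apply: (scalerI c0).
  by rewrite scalerAr scalerA divff // scale1r E Ec mulrC mul_mpolyC.
have [l [B' [ll hB' EB]]] := pq_homog_line_factor hB.
have [l0 B'0] : l != 0 /\ B' != 0.
  by move: B0; rewrite EB mulf_eq0 negb_or => /andP.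
rewrite addnS in hH.
have [|H' hH' EH] := pq_free_line_divides fr ll hH.
  by exists (g * B'); rewrite E EB mulrCA.
apply: (IHn H' B') => //; apply: (mulfI l0).
by rewrite mulrCA -EH E EB mulrCA.
Qed.

End PQFree.

(** * Algebraically independent p and q *)

Lemma unit_const (k : fieldType) n (u : {mpoly k[n]}) :
  u \is a GRing.unit -> exists c, u = c%:MP.
Proof. by case/andP => /eqP -> _; eexists. Qed.

Lemma der_scale_der (k : fieldType) (f : {mpoly k[2]}) D :
  is_derivation (@polyconst k) D -> is_derivation (@polyconst k) (scale_der f D).
Proof.
move=> derD; rewrite /scale_der; split=> [u v|c u|u v].
- by rewrite (der_add derD) mulrDr.
- by rewrite (der_scale derD) mulrCA.
by rewrite (der_mul derD) mulrDr mulrA [f * (u * _)]mulrCA.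
Qed.

Lemma bracket_scale_der (k : fieldType) (f g : {mpoly k[2]}) D :
  is_derivation (@polyconst k) D ->
  bracket (scale_der f D) (scale_der g D) = scale_der (f * D g - g * D f) D.
Proof.
move=> derD; apply: functional_extensionality => u; rewrite /bracket /scale_der.
rewrite !(der_mul derD); ring.
Qed.

Section IndependentPair.
Variables (k : fieldType) (p q : {mpoly k[2]}).
Local Notation kxy := {mpoly k[2]}.
Local Notation ratfun := {fraction {mpoly k[2]}}.
Hypothesis pq_indep : alg_independent (@polyconst k) (tnth [tuple p; q]).

(** A form of positive degree minus a constant would be a relation between p
  and q. *)
Lemma pq_homog_const0 m c : (0 < m)%N -> pq_homog p q m c%:MP -> c = 0.
Proof.
move=> m0 [F Fm EF]; have F0 : F - c%:MP = 0.
  apply: pq_indep; rewrite raddfB /= mmapC /polyconst.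
  by rewrite [X in X - _](_ : _ = F \mPo [tuple p; q]) // -EF subrr.
have : F@_0%MM = 0 by apply: (dhomog_nemf_coeff Fm); rewrite /= mdeg0 neq_ltn m0.
by move/eqP: F0; rewrite subr_eq0 => /eqP ->; rewrite mcoeffC eqxx mulr1.
Qed.

Lemma pq_homog_nonconst m g : (0 < m)%N -> pq_homog p q m g -> g != 0 ->
  (1 < msize g)%N.
Proof.
move=> m0 hg g0; rewrite ltnNge; apply/negP => /msize1_polyC Eg.
by case/eqP: g0; move: hg; rewrite Eg => /(pq_homog_const0 m0) ->; rewrite mpolyC0.
Qed.

(** Forms of positive degree are split off f as long as possible; they are not
  constant, so the degree of f decreases. *)
Lemma pq_free_decomposition f : f != 0 ->
  exists (m : nat) (fbar h : kxy),
    [/\ pq_free p q fbar, pq_homog p q m h & f = fbar * h].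
Proof.
move: {2}(msize f) (leqnn (msize f)) => n; elim: n f => [f|n IHn f sf f0].
  by rewrite leqn0 msize_poly_eq0 => /eqP-> /eqP.
case: (classic (pq_free p q f)) => [fr|nfr].
  by exists 0%N, f, 1; rewrite mulr1; split=> //; apply: pq_homog1.
have [m [g [m0 hg [f' Ef]]]] : exists m g,
    [/\ (0 < m)%N, pq_homog p q m g & divides g f].
  apply: NNPP => H; apply: nfr => m g m0 hg gf; apply: H; by exists m, g.
have [g0 f'0] : g != 0 /\ f' != 0 by move: f0; rewrite Ef mulf_eq0 negb_or => /andP.
have [||m' [fbar [h [fr hh Ef']]]] := IHn f' => //.
  have := pq_homog_nonconst m0 hg g0; move: sf; rewrite Ef msizeM //.
  case: (msize g) => [//|[//|s]] /= sf _; rewrite -ltnS; apply: leq_trans sf.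
  by rewrite !addSn /= ltnS leq_addl.
exists (m' + m)%N, fbar, (h * g); split=> //; first exact: pq_homogM.
by rewrite Ef Ef' mulrC mulrA.
Qed.

Lemma p_neq0 : p != 0.
Proof.
apply/eqP => p0; have : 'X_xvar = 0 :> kxy.
  by apply: pq_indep; rewrite mmapX mmap1U.
move/(congr1 (mcoeff U_(xvar))); rewrite mcoeffXU mcoeff0 eqxx => /eqP.
by rewrite oner_eq0.
Qed.

Lemma q_neq0 : q != 0.
Proof.
apply/eqP => q0; have : 'X_yvar = 0 :> kxy.
  by apply: pq_indep; rewrite mmapX mmap1U.
move/(congr1 (mcoeff U_(yvar))); rewrite mcoeffXU mcoeff0 eqxx => /eqP.
by rewrite oner_eq0.
Qed.

Lemma pq_indep_ratfun : alg_independent (@ratconst k)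
  (fun i => (tnth [tuple p; q] i)%:F : ratfun).
Proof.
move=> F F0; apply: pq_indep; apply/eqP; rewrite -tofrac_eq0 -[X in _ == X]F0.
apply/eqP; move: F {F0}; apply: mpoly_gen_ind => [c|i|u v Eu Ev|u v Eu Ev].
- by rewrite !mmapC.
- by rewrite !mmapX !mmap1U.
- by rewrite !mmapD tofracD Eu Ev.
by rewrite !rmorphM /= Eu Ev.
Qed.

(** Irreducible elements with a common nonunit factor are proportional, which
  independence forbids. *)
Lemma coprime_pq : irreducible p -> irreducible q -> coprime_elts p q.
Proof.
case=> [p0 pN pI] [q0 qN qI] e [a Ea] [b Eb].
case: (pI e a Ea) => // ua; case: (qI e b Eb) => // ub.
have [a' Ea'] := unit_const ua; have [b' Eb'] := unit_const ub.
have E0 : b' *: 'X_xvar - a' *: 'X_yvar = 0 :> kxy.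
  apply: pq_indep; rewrite raddfB /= !mmapZ !mmapX !mmap1U.
  rewrite -[LHS]/(b'%:MP * p - a'%:MP * q) -Ea' -Eb' {1}Ea Eb; ring.
have b0 : b' = 0.
  have := congr1 (mcoeff U_(xvar)) E0.
  by rewrite mcoeffB !mcoeffZ !mcoeffXU mulr1 mulr0 subr0 mcoeff0.
by move: ub; rewrite Eb' b0 mpolyC0 unitr0.
Qed.

Definition jacobian : kxy := p^`M(xvar) * q^`M(yvar) - p^`M(yvar) * q^`M(xvar).

(** The derivation p_y d/dx - p_x d/dy kills p and has value minus the Jacobian
  at q.  If it killed q as well, it would be zero by [der_indep_eq0], and p
  would be constant. *)
Lemma jacobian_neq0 : [pchar k] =i pred0 -> jacobian != 0.
Proof.
move=> char0; apply/eqP => J0.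
pose D (u : kxy) := p^`M(yvar) * u^`M(xvar) + (- p^`M(xvar)) * u^`M(yvar).
have derD : is_derivation (@polyconst k) D := gradient_derivation _ _.
have Dpq i : frac_der D (tnth [tuple p; q] i)%:F = 0.
  rewrite (frac_der_poly (der_mul derD)).
  have -> : D (tnth [tuple p; q] i) = 0; last exact: tofrac0.
  case: (ord2P i) => ->; rewrite /D /tnth /=; first by ring.
  by rewrite mulNr -opprB -[RHS]oppr0 -J0.
have D0 w : D w = 0.
  apply/eqP; rewrite -tofrac_eq0 -(frac_der_poly (der_mul derD)); apply/eqP.
  exact: (der_indep_eq0 char0 (frac_der_derivation derD) Dpq pq_indep_ratfun).
have px : p^`M(xvar) = 0.
  have := D0 'X_yvar; rewrite /D !mderivXU eqxx mulr1 mulr0 add0r => /eqP.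
  by rewrite oppr_eq0 => /eqP.
have py : p^`M(yvar) = 0.
  by have := D0 'X_xvar; rewrite /D !mderivXU eqxx mulr1 mulr0 addr0.
have Ep := mderiv_const char0 px py; have := pq_homog_p p q.
rewrite {2}Ep => /pq_homog_const0 -/(_ isT) c0.
by have := p_neq0; rewrite Ep c0 mpolyC0 eqxx.
Qed.

End IndependentPair.

(** * The annihilator of phi and its abelian subalgebras *)

Section Delta.
Variables (k : closedFieldType) (char0 : [pchar k] =i pred0).
Variables (phi : {fraction {mpoly k[2]}}).
Hypothesis phi_nonconst : forall c : k, phi <> ratconst c.
Variables (p q : {mpoly k[2]}).
Hypotheses (p_irr : irreducible p) (q_irr : irreducible q).
Hypothesis pq_indep : alg_independent (@polyconst k) (tnth [tuple p; q]).
Hypothesis pq_gen : generative phi (p%:F / q%:F).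
Variable delta : {mpoly k[2]} -> {mpoly k[2]}.
Hypothesis delta_pq : is_delta p q delta.
Local Notation kxy := {mpoly k[2]}.
Local Notation ratfun := {fraction {mpoly k[2]}}.

Let p0 := p_neq0 pq_indep.
Let q0 := q_neq0 pq_indep.

Lemma delta_derivation : is_derivation (@polyconst k) delta.
Proof. by have [d [P [Q [_ _ _ ->]]]] := delta_pq; apply: gradient_derivation. Qed.
Let derd := delta_derivation.

(** Before the division by the gcd d, delta multiplies p and q by the
  Jacobian. *)
Lemma delta_eigen : exists d,
  [/\ d * delta p = jacobian p q * p & d * delta q = jacobian p q * q].
Proof.
have [d [P [Q [_ EP EQ ->]]]] := delta_pq; exists d; rewrite /jacobian.
by split; rewrite mulrDr !mulrA -EP -EQ; ring.
Qed.

Lemma delta_p_neq0 : delta p != 0.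
Proof.
have [d [Ep _]] := delta_eigen.
apply: contraTneq (jacobian_neq0 pq_indep char0) => dp.
by move/eqP: Ep; rewrite dp mulr0 eq_sym mulf_eq0 (negPf p0) orbF negbK.
Qed.

Lemma delta_pq_comm : delta p * q = p * delta q.
Proof.
have [d [Ep Eq]] := delta_eigen.
have d0 : d != 0.
  apply: contraTneq (jacobian_neq0 pq_indep char0) => d0.
  by move/eqP: Ep; rewrite d0 mul0r eq_sym mulf_eq0 (negPf p0) orbF negbK.
by apply: (mulfI d0); rewrite mulrA Ep [RHS]mulrCA Eq; ring.
Qed.

Lemma frac_der_scale_pq g : frac_der (scale_der g delta) (p%:F / q%:F) = 0.
Proof.
have derg := der_scale_der g derd.
apply: (der_quotient (frac_der_derivation derg)); first by rewrite tofrac_eq0.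
rewrite !(frac_der_poly (der_mul derg)) -!tofracM /scale_der; congr (_%:F).
by rewrite -mulrA delta_pq_comm mulrCA.
Qed.

(** If D = a d/dx + b d/dy kills p/q, then a Q = b P for the coefficients P, Q
  of delta, which are coprime. *)
Lemma annihilatorP D :
  annihilator phi D <-> exists g, D = scale_der g delta.
Proof.
split=> [[derD [D' [derD' D'E D'phi]]]|[g ->]]; last first.
  have derg := der_scale_der g derd; split=> //.
  exists (frac_der (scale_der g delta)); split.
  - exact: frac_der_derivation.
  - exact: (frac_der_poly (der_mul derg)).
  apply: (der_adjoin (frac_der_derivation derg) (frac_der_scale_pq g)).
  by case: pq_gen => [[]].
have Dpq : D p * q = p * D q.
  apply/eqP; rewrite -tofrac_eq !tofracM -!D'E; apply/eqP.
  apply: (der_quotient0 derD'); first by rewrite tofrac_eq0.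
  exact: (der_generative char0 derD' phi_nonconst pq_gen D'phi).
have [d [P [Q [[_ _ gcd_max] EP EQ Ed]]]] := delta_pq.
have d0 : d != 0.
  apply: contraTneq (jacobian_neq0 pq_indep char0) => d0.
  have : jacobian p q * p = d * (P * p^`M(xvar) + Q * p^`M(yvar)).
    by rewrite mulrDr !mulrA -EP -EQ /jacobian; ring.
  by move/eqP; rewrite d0 mul0r mulf_eq0 (negPf p0) orbF negbK.
have cPQ : coprime_elts P Q.
  move=> e [x Ex] [y Ey]; have [||c Ec] := gcd_max (d * e).
  - by exists x; rewrite EP Ex mulrA.
  - by exists y; rewrite EQ Ey mulrA.
  apply/unitrP; exists c; rewrite [c * e]mulrC; split; apply: (mulfI d0).
    by rewrite mulrA -Ec mulr1.
  by rewrite mulrA -Ec mulr1.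
pose a := D 'X_xvar; pose b := D 'X_yvar.
have EaQ : a * Q = b * P.
  apply: (mulfI d0); rewrite [LHS]mulrCA [RHS]mulrCA -EP -EQ.
  move: Dpq; rewrite (mpoly_derE derD p) (mpoly_derE derD q) -/a -/b => E.
  apply/eqP; rewrite -subr_eq0; apply/eqP.
  move/eqP: E; rewrite -subr_eq0 => /eqP <-; ring.
suff [g [Ea Eb]] : exists g, a = P * g /\ b = Q * g.
  exists g; apply: functional_extensionality => u.
  by rewrite (mpoly_derE derD) -/a -/b /scale_der Ed Ea Eb; ring.
have [P0|P0] := eqVneq P 0; last first.
  have [g Ea] := mpoly_euclid cPQ EaQ; exists g; split=> //.
  by apply: (mulIf P0); rewrite -EaQ Ea; ring.
have [g Eb] := mpoly_euclid (coprime_elts_sym cPQ) (esym EaQ).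
exists g; split=> //; rewrite P0 mul0r; apply/eqP.
have Q0 : Q != 0.
  apply/eqP => Q0; have := delta_p_neq0.
  by rewrite Ed P0 Q0 !mul0r addr0 eqxx.
by move/eqP: EaQ; rewrite P0 mulr0 mulf_eq0 (negPf Q0) orbF.
Qed.

Lemma scale_delta_inj f g : scale_der f delta = scale_der g delta -> f = g.
Proof.
by move/(congr1 (fun D => D p)); rewrite /scale_der => /(mulIf delta_p_neq0).
Qed.

Lemma scale_delta0 : scale_der 0 delta = (fun _ => 0).
Proof. by apply: functional_extensionality => u; rewrite /scale_der mul0r. Qed.

Lemma bracket_delta0 f g :
  bracket (scale_der f delta) (scale_der g delta) = (fun _ => 0) <->
  f * delta g = g * delta f.
Proof.
rewrite bracket_scale_der // -scale_delta0; split=> [/scale_delta_inj/eqP|->].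
  by rewrite subr_eq0 => /eqP.
by rewrite subrr.
Qed.

(** Euler's identity, cleared of the denominator p. *)
Lemma delta_homog m g : pq_homog p q m g -> p * delta g = m%:R * g * delta p.
Proof.
case/pq_homogP => P _ ->; rewrite /form (big_morph _ (der_add derd) (der_0 derd)).
rewrite !mulr_sumr !mulr_suml; apply: eq_bigr => i _.
have im : (i <= m)%N by rewrite -ltnS.
have Xp : p * delta (p ^+ i) = i%:R * p ^+ i * delta p.
  rewrite (der_exp derd); case: (val i) => [|n]; rewrite ?mulr0n ?mul0r ?mulr0 //=.
  by rewrite mulrA mulrnAr -exprS mulr_natl.
have Xq n : p * delta (q ^+ n) = n%:R * q ^+ n * delta p.
  rewrite (der_exp derd); case: n => [|n]; rewrite ?mulr0n ?mul0r ?mulr0 //=.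
  by rewrite mulrCA -delta_pq_comm -[_ *+ _]mulr_natl exprS; ring.
rewrite -!mul_mpolyC -/(polyconst _) (der_scale derd) (der_mul derd).
have -> : m%:R = (m - i)%:R + i%:R :> kxy by rewrite -natrD subnK.
transitivity (polyconst P`_i * ((p * delta (p ^+ i)) * q ^+ (m - i) +
  p ^+ i * (p * delta (q ^+ (m - i))))); first by ring.
rewrite Xp Xq; ring.
Qed.

Lemma homog_commute m f g h : pq_homog p q m g -> pq_homog p q m h ->
  (g * f) * delta (h * f) = (h * f) * delta (g * f).
Proof.
move=> hg hh; rewrite !(der_mul derd).
apply: (mulfI p0).
transitivity (g * f * (p * delta h * f + p * h * delta f)); first by ring.
transitivity (h * f * (p * delta g * f + p * g * delta f)); last by ring.
rewrite (delta_homog hg) (delta_homog hh); ring.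
Qed.

(** The quotient g / f is killed by delta, hence a quotient A / B of forms of
  equal degree, and [pq_free_quotient] applies to g B = fbar (h A). *)
Lemma commute_homog m f fbar h g : f != 0 ->
  pq_free p q fbar -> pq_homog p q m h -> f = fbar * h ->
  f * delta g = g * delta f -> exists2 h', pq_homog p q m h' & g = h' * fbar.
Proof.
move=> f0 fr hh Ef E.
have derd' := frac_der_derivation derd.
have fp u : frac_der delta u%:F = (delta u)%:F := frac_der_poly (der_mul derd) u.
have Dfg : frac_der delta (g%:F / f%:F) = 0.
  apply: (der_quotient derd'); first by rewrite tofrac_eq0.
  by rewrite !fp -!tofracM [delta g * f]mulrC E.
have Dpq : frac_der delta (p%:F / q%:F) = 0.
  apply: (der_quotient derd'); first by rewrite tofrac_eq0.
  by rewrite !fp -!tofracM delta_pq_comm.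
have dp : frac_der delta p%:F <> 0.
  by rewrite fp => /eqP; rewrite tofrac_eq0 (negPf delta_p_neq0).
have := der_kernel_generative char0 derd' pq_gen dp Dpq Dfg.
case/(adjoin_homog q0) => n [A [B [hA hB B0 EAB]]].
have EgB : g * B = A * f.
  apply/eqP; rewrite -tofrac_eq !tofracM; apply/eqP.
  by apply: eq_div_cross EAB; rewrite tofrac_eq0.
have [|h' hh' Eg] := pq_free_quotient (coprime_pq pq_indep p_irr q_irr) fr
  (pq_homogM hh hA) hB B0 (g := g).
  by rewrite EgB Ef; ring.
by exists h'; rewrite // mulrC.
Qed.

Lemma pq_space_abelian m fbar :
  is_abelian_subalgebra (annihilator phi) (pq_space p q m fbar delta).
Proof.
have br D E : pq_space p q m fbar delta D -> pq_space p q m fbar delta E ->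
    bracket D E = (fun _ => 0).
  case=> g hg -> [h hh ->]; apply/bracket_delta0; exact: homog_commute hg hh.
have z : pq_space p q m fbar delta (fun _ => 0).
  by exists 0; [apply: pq_homog0|rewrite mul0r scale_delta0].
split=> //; split.
- by move=> D [g _ ->]; apply/annihilatorP; eexists.
- split=> // a D E [g hg ->] [h hh ->]; exists (a *: g + h).
    by apply: pq_homogD => //; apply: pq_homogZ.
  apply: functional_extensionality => u; rewrite /scale_der.
  by rewrite mulrDl mulrDl !scalerAl.
by move=> D E SD SE; rewrite br.
Qed.

Lemma centralizerP m f fbar h E : f != 0 ->
  pq_free p q fbar -> pq_homog p q m h -> f = fbar * h ->
  centralizer (annihilator phi) (scale_der f delta) E <->
  pq_space p q m fbar delta E.
Proof.
move=> f0 fr hh Ef; split=> [[/annihilatorP [g ->] /bracket_delta0 EE]|[g hg ->]].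
  by have [h' hh' ->] := commute_homog f0 fr hh Ef EE; exists h'.
split; first by apply/annihilatorP; eexists.
by apply/bracket_delta0; rewrite Ef [fbar * h]mulrC; apply: homog_commute hh hg.
Qed.

Lemma pq_free_neq0 fbar : pq_free p q fbar -> fbar != 0.
Proof.
move=> fr; apply/eqP => f0; apply: (fr 1%N p) => //; first exact: pq_homog_p.
by exists 0; rewrite f0 mulr0.
Qed.

(** An abelian overalgebra centralizes the element p ^ m fbar delta. *)
Lemma pq_space_maximal m fbar : pq_free p q fbar ->
  is_maximal_abelian_subalgebra (annihilator phi) (pq_space p q m fbar delta).
Proof.
move=> fr; split; first exact: pq_space_abelian.
move=> T [[TA _ _] Tab] ST E TE.
have hp : pq_homog p q m (p ^+ m).
  by have := pq_homogpq p q m 0; rewrite mulr1 addn0.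
apply/(@centralizerP m (fbar * p ^+ m) fbar (p ^+ m)) => //.
  by apply: mulf_neq0; [apply: pq_free_neq0|apply: expf_neq0; exact: p0].
split; first exact: TA.
by apply: Tab => //; apply: ST; exists (p ^+ m); rewrite // mulrC.
Qed.

(** The zero algebra is not maximal, as it lies in the line spanned by delta;
  any nonzero element then determines the algebra as its centralizer. *)
Lemma maximal_abelian_pq_space S :
  is_maximal_abelian_subalgebra (annihilator phi) S ->
  exists (m : nat) (fbar : kxy),
    pq_free p q fbar /\ forall D, S D <-> pq_space p q m fbar delta D.
Proof.
move=> [[[SA _ _] Sab] Smax].
have [f [f0 Sf]] : exists f, f != 0 /\ S (scale_der f delta).
  apply: NNPP => S0.
  have SE f : S (scale_der f delta) -> f = 0.
    move=> Sf; apply/eqP/negPn/negP => f0; apply: S0; by exists f.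
  have S1 : S (scale_der (1 * 1) delta).
    apply: (Smax _ (pq_space_abelian 0 1)); last first.
      by exists 1; first exact: pq_homog1.
    move=> D SD; have /annihilatorP [f Ef] := SA D SD.
    rewrite Ef in SD *; rewrite (SE f SD); exists 0; first exact: pq_homog0.
    by rewrite mul0r.
  by have /eqP := SE _ S1; rewrite mulr1 oner_eq0.
have [m [fbar [h [fr hh Ef]]]] := pq_free_decomposition pq_indep f0.
have SP D : S D -> pq_space p q m fbar delta D.
  move=> SD; apply/(centralizerP D f0 fr hh Ef); split; first exact: SA.
  exact: Sab.
exists m, fbar; split=> // D; split; first exact: SP.
exact: Smax (pq_space_abelian m fbar) SP D.
Qed.

Lemma pq_space_finite m fbar : finite_dimensional (pq_space p q m fbar delta).
Proof.
exists m.+1, (fun i : 'I_m.+1 => scale_der (p ^+ i * q ^+ (m - i) * fbar) delta).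
split=> [i|D [g /pq_homogP [P _ ->] ->]].
  exists (p ^+ i * q ^+ (m - i)) => //.
  by have := pq_homogpq p q i (m - i); rewrite subnKC // -ltnS.
exists (fun i => P`_i); apply: functional_extensionality => u.
rewrite /scale_der /form !mulr_suml; apply: eq_bigr => i _.
by rewrite !scalerAl.
Qed.

End Delta.

Unset Implicit Arguments.

Theorem theorem12 (k : closedFieldType) (char0 : [pchar k] =i pred0)
    (phi : {fraction {mpoly k[2]}})
    (phi_nonconst : forall c : k, phi <> ratconst c)
    (phi_nopoly : ~ exists r : {mpoly k[2]}, generative phi r%:F)
    (p q : {mpoly k[2]})
    (p_irr : irreducible p) (q_irr : irreducible q)
    (pq_indep : alg_independent (@polyconst k) (tnth [tuple p; q]))
    (pq_gen : generative phi (p%:F / q%:F))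
    (delta : {mpoly k[2]} -> {mpoly k[2]}) (delta_pq : is_delta p q delta) :
  (forall f : {mpoly k[2]},
     f != 0 -> annihilator phi (scale_der f delta) ->
     (exists (m : nat) (fbar h : {mpoly k[2]}),
        [/\ pq_free p q fbar, pq_homog p q m h & f = fbar * h]) /\
     (forall (m : nat) (fbar h : {mpoly k[2]}),
        pq_free p q fbar -> pq_homog p q m h -> f = fbar * h ->
        forall E : {mpoly k[2]} -> {mpoly k[2]},
          centralizer (annihilator phi) (scale_der f delta) E <->
          pq_space p q m fbar delta E)) /\
  [/\ forall S : ({mpoly k[2]} -> {mpoly k[2]}) -> Prop,
        is_maximal_abelian_subalgebra (annihilator phi) S ->
        exists (m : nat) (fbar : {mpoly k[2]}),
          pq_free p q fbar /\
          forall D, S D <-> pq_space p q m fbar delta D,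
      forall (m : nat) (fbar : {mpoly k[2]}),
        pq_free p q fbar ->
        is_maximal_abelian_subalgebra (annihilator phi)
          (pq_space p q m fbar delta) &
      forall S : ({mpoly k[2]} -> {mpoly k[2]}) -> Prop,
        is_maximal_abelian_subalgebra (annihilator phi) S ->
        finite_dimensional S].
Proof.
  split=> [f f0 _|].
    split; first exact: pq_free_decomposition pq_indep f f0.
    move=> m fbar h fr hh Ef E.
    exact: (centralizerP char0 phi_nonconst p_irr q_irr pq_indep pq_gen
      delta_pq E f0 fr hh Ef).
  have maxP := maximal_abelian_pq_space char0 phi_nonconst p_irr q_irr pq_indep
    pq_gen delta_pq.
  split=> [S /maxP //|m fbar fr|S /maxP [m [fbar [fr SP]]]].
    exact: (pq_space_maximal char0 phi_nonconst p_irr q_irr pq_indep pq_gen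
      delta_pq).
  have [n [b [bS bgen]]] := pq_space_finite p q delta m fbar.
  exists n, b; split=> [i|D SD]; first by apply/SP.
  by apply: bgen; apply/SP.
Qed.
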